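(* (a) Let $(H,\mathfrak m)$ be a strongly primary monoid, and let $\mathfrak f=(H:\widehat H)$. Consider the following conditions: (1) $H$ is globally tame. (2) $\bigcap_{u\in\mathcal A(H)} uH\ne\emptyset$. (3) $\rho(H)<\infty$. (4) $\rho_k(H)<\infty$ for all $k\in\mathbb N$. (5) $\Lambda(H)=\infty$. (6) $\widehat H$ is a primary valuation monoid. (7) $\widehat H$ is a valuation monoid. (8) $\mathfrak f\mathfrak m\subseteq\bigcap_{u\in\mathcal A(H)}u\widehat H$. (9) $\mathfrak f^2\mathfrak m\subseteq\bigcap_{u\in\mathcal A(H)}uH$. Then conditions (1) and (2) are equivalent, and each of the first four conditions implies its successor (that is, (1)$\Rightarrow$(2)$\Rightarrow$(3)$\Rightarrow$(4)$\Rightarrow$(5)). Moreover, if $\mathfrak f\ne\emptyset$, then all nine conditions are equivalent. (b) Let $(R,M)$ be a strongly primary domain, and let $\mathfrak f=(R:\widehat R)$. Then the following nine conditions are equivalent: (1) $R$ is globally tame. (2) $\bigcap_{u\in\mathcal A(R)}uR^\bullet\ne\emptyset$. (3) $\rho(R)<\infty$. (4) $\rho_k(R)<\infty$ for all $k\in\mathbb N$. (5) $\Lambda(R)=\infty$. (6) $\widehat R$ is a primary valuation domain and $\mathfrak f\ne(0)$. (7) $\widehat R$ is a valuation domain and $\mathfrak f\ne(0)$. (8) $(0)\ne\mathfrak fM\subseteq\bigcap_{u\in\mathcal A(R)}u\widehat R$. (9) $(0)\ne\mathfrak f^2M\subseteq\bigcap_{u\in\mathcal A(R)}uR$.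
   Context: A monoid is a commutative cancellative semigroup with identity; a domain is a commutative integral domain. $\mathbb N=\{1,2,\dots\}$, $\mathbb N_0=\mathbb N\cup\{0\}$. For a monoid $H$: $H^\times$ is the unit group, $\mathfrak m=H\setminus H^\times$ (the notation $(H,\mathfrak m)$ records this), $\mathsf q(H)$ the quotient group, $\mathcal A(H)$ the set of atoms (irreducible elements), $H_{\rm red}=\{aH^\times: a\in H\}$. The complete integral closure is $\widehat H=\{x\in\mathsf q(H): \exists c\in H,\ cx^n\in H\ \forall n\in\mathbb N\}$. For $X,Y\subseteq\mathsf q(H)$, $(X:Y)=\{z\in\mathsf q(H): zY\subseteq X\}$ and $XY=\{xy:x\in X,y\in Y\}$. $H$ is primary if $H\ne H^\times$ and for all $a,b\in\mathfrak m$ there is $n\in\mathbb N$ with $b^n\in aH$; strongly primary if $H\ne H^\times$ and for every $a\in\mathfrak m$ there is $n\in\mathbb N$ with $\mathfrak m^n\subseteq aH$. Strongly primary monoids are atomic. $H$ is a valuation monoid if for all $a,b\in H$ we have $a\mid b$ or $b\mid a$. $\mathsf Z(H)$ is the free abelian monoid on $\mathcal A(H_{\rm red})$, $\pi:\mathsf Z(H)\to H_{\rm red}$ the canonical homomorphism, $\mathsf Z(a)=\pi^{-1}(aH^\times)$ the set of factorizations of $a$, $|z|$ the length of $z\in\mathsf Z(H)$, and $\mathsf L(a)=\{|z|:z\in\mathsf Z(a)\}\subseteq\mathbb N_0$. For $z,z'\in\mathsf Z(H)$, after cancelling their greatest common divisor in $\mathsf Z(H)$ they become products of $m$ and $n$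 atoms respectively, and $\mathsf d(z,z')=\max\{m,n\}$. $\Lambda(H)=\sup\{\min\mathsf L(a):a\in H\}$; for $H\neq H^\times$, $\rho_k(H)=\sup\{\sup\mathsf L(a): a\in H,\ k\in\mathsf L(a)\}$; $\rho(H)=\sup\{m/n: m,n\in\mathsf L(a),\ a\in H\setminus H^\times\}$. For $u\in\mathcal A(H_{\rm red})$, $\mathsf t(u)$ is the smallest $N\in\mathbb N_0\cup\{\infty\}$ such that whenever $a\in H$ with $\mathsf Z(a)\cap u\mathsf Z(H)\ne\emptyset$ and $z\in\mathsf Z(a)$, there is $z'\in\mathsf Z(a)\cap u\mathsf Z(H)$ with $\mathsf d(z,z')\le N$. $H$ is globally tame if $\sup\{\mathsf t(u):u\in\mathcal A(H_{\rm red})\}<\infty$. For a domain $R$, $R^\bullet=R\setminus\{0\}$ is its multiplicative monoid; $R$ is called strongly primary, primary, or globally tame if the monoid $R^\bullet$ has the respective property, and $\mathcal A(R)=\mathcal A(R^\bullet)$, $\rho(R)=\rho(R^\bullet)$, $\rho_k(R)=\rho_k(R^\bullet)$, $\Lambda(R)=\Lambda(R^\bullet)$. $\widehat R=\widehat{R^\bullet}\cup\{0\}$, $(R:\widehat R)=\{z: z\widehat R\subseteq R\}$ inside the quotient field, and $(R,M)$ means that $R$ is local (unique maximal ideal, not necessarily noetherian) with maximal ideal $M$. *)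

(* Defs.v *)
From HB Require Import structures.
From mathcomp Require Import all_boot all_order all_algebra.
From mathcomp Require Import finmap multiset.
From mathcomp Require Import all_classical all_reals.
From mathcomp Require Import ereal Rstruct.

Set Implicit Arguments.
Unset Strict Implicit.
Unset Printing Implicit Defensive.

Import GRing.Theory.
Local Open Scope classical_set_scope.
Local Open Scope quotient_scope.
Local Open Scope group_scope.

HB.mixin Record Monoid_isCancelCommutative H of monoid.Monoid H := {
  cmulC : @commutative H H monoid.mul;
  cmulI : forall a : H, injective (monoid.mul a)
}.

#[short(type="cmonoidType")]
HB.structure Definition CMonoid :=
  {H of Monoid_isCancelCommutative H & monoid.Monoid H}.

Section CMonoidTheory.
Variable H : cmonoidType.
Implicit Types a b c : H.

Lemma cmulA a b c : a * (b * c) = a * b * c. Proof. exact: mulgA. Qed.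

Lemma cmulCA a b c : a * (b * c) = b * (a * c).
Proof. by rewrite !cmulA (cmulC a). Qed.

Lemma cmulACA a b c d : (a * b) * (c * d) = (a * c) * (b * d).
Proof. by rewrite -!cmulA (cmulCA b). Qed.

Lemma cexpM a b n : (a * b) ^+ n = a ^+ n * b ^+ n.
Proof. by elim: n => [|n IHn]; rewrite ?mulg1// !expgS IHn cmulACA. Qed.
End CMonoidTheory.

Section Arithmetic.
Variable H : cmonoidType.
Implicit Types (a b u : H) (X Y : set H).

Definition units : set H := [set a | exists b, a * b = 1].
Definition nonunits : set H := ~` units.

Definition dvdm a b : Prop := exists c, b = a * c.
Definition prideal a : set H := [set a * x | x in [set: H]].

Definition atoms : set H :=
  [set u | nonunits u /\ forall a b, u = a * b -> units a \/ units b].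

Definition setmul X Y : set H := [set x * y | x in X & y in Y].
Definition setexp X (n : nat) : set H := iter n (setmul X) [set 1].

Definition primary : Prop :=
  units <> [set: H] /\
  forall a b, nonunits a -> nonunits b ->
    exists n : nat, (0 < n)%N /\ prideal a (b ^+ n).

Definition strongly_primary : Prop :=
  units <> [set: H] /\
  forall a, nonunits a ->
    exists n : nat, (0 < n)%N /\ setexp nonunits n `<=` prideal a.

Definition valuation : Prop := forall a b, dvdm a b \/ dvdm b a.

End Arithmetic.

Arguments units H : clear implicits.
Arguments nonunits H : clear implicits.
Arguments atoms H : clear implicits.
Arguments primary H : clear implicits.
Arguments strongly_primary H : clear implicits.
Arguments valuation H : clear implicits.

Section Reduced.
Variable H : cmonoidType.
Implicit Types a b c : H.

Definition assoc a b : bool := `[< exists2 e, units H e & b = a * e >].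

Lemma assoc_refl : reflexive assoc.
Proof. by move=> a; apply/asboolP; exists 1; [exists 1|]; rewrite mulg1. Qed.

Lemma assoc_imp a b : assoc a b -> assoc b a.
Proof.
move=> /asboolP[e [f ef] ->]; apply/asboolP; exists f.
  by exists e; rewrite cmulC.
by rewrite -cmulA ef mulg1.
Qed.

Lemma assoc_sym : symmetric assoc.
Proof. by move=> a b; apply/idP/idP; apply: assoc_imp. Qed.

Lemma assoc_trans : transitive assoc.
Proof.
move=> b a c /asboolP[e [e' ee'] ->] /asboolP[f [f' ff'] ->].
apply/asboolP; exists (e * f); last by rewrite cmulA.
by exists (e' * f'); rewrite cmulACA ee' ff' mulg1.
Qed.

Canonical assoc_equiv := EquivRel assoc assoc_refl assoc_sym assoc_trans.

(* The class of [a] is the coset [a H^*]. *)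
Definition Hred := {eq_quot assoc}.
HB.instance Definition _ : EqQuotient _ assoc Hred := EqQuotient.on Hred.
HB.instance Definition _ := Choice.on Hred.

Definition red_one : Hred := \pi_Hred 1.
Definition red_mul := lift_op2 Hred (fun a b : H => a * b).

Lemma pi_red_mul : {morph \pi_Hred : a b / a * b >-> red_mul a b}.
Proof.
move=> a b; unlock red_mul; apply/eqmodP => /=.
have /eqmodP/asboolP[e [e' ee'] ea] : a = repr (\pi_Hred a) %[mod Hred].
  by rewrite reprK.
have /eqmodP/asboolP[f [f' ff'] fb] : b = repr (\pi_Hred b) %[mod Hred].
  by rewrite reprK.
apply/asboolP; exists (e * f); last by rewrite ea fb cmulACA.
by exists (e' * f'); rewrite cmulACA ee' ff' mulg1.
Qed.
Canonical pi_red_mul_morph := PiMorph2 pi_red_mul.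

Lemma red_mulA : associative red_mul.
Proof.
by elim/quotW=> a; elim/quotW=> b; elim/quotW=> c; rewrite !piE cmulA.
Qed.

Lemma red_mulC : commutative red_mul.
Proof. by elim/quotW=> a; elim/quotW=> b; rewrite !piE cmulC. Qed.

Lemma red_mul1 : left_id red_one red_mul.
Proof. by elim/quotW=> a; rewrite /red_one !piE mul1g. Qed.

Lemma red_mulr1 : right_id red_one red_mul.
Proof. by move=> a; rewrite red_mulC red_mul1. Qed.

Lemma red_mulI (x : Hred) : injective (red_mul x).
Proof.
elim/quotW: x => a; elim/quotW=> b; elim/quotW=> c; rewrite !piE.
move=> /eqmodP/asboolP[e ue]; rewrite -cmulA => /cmulI ->.
by apply/eqmodP/asboolP; exists e.
Qed.

HB.instance Definition _ := isMonoid.Build Hred red_mulA red_mul1 red_mulr1.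
HB.instance Definition _ :=
  Monoid_isCancelCommutative.Build Hred red_mulC red_mulI.
End Reduced.

Section Factorizations.
Variable H : cmonoidType.
Implicit Types (a : H) (k : nat).

Local Notation RR := Rdefinitions.R.

(* The free abelian monoid on the atoms of [Hred H] is written with multisets:
   the product is [`+`], the greatest common divisor is [`&`]. *)
Definition Zmon := {mset set_type (atoms (Hred H))}%mset.
Implicit Types (z : Zmon) (u : set_type (atoms (Hred H))).

Definition Zpi z : Hred H := \prod_(u <- enum_mset z) val u.
Definition Zfact a : set Zmon := [set z | Zpi z = \pi_(Hred H) a].
Definition Lset a : set nat := [set size (enum_mset z) | z in Zfact a].

Definition Zmul z : set Zmon := [set (z `+` y)%mset | y in [set: Zmon]].

Definition Zdist z z' : nat :=
  let g := (z `&` z')%mset in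
  maxn (size (enum_mset (z `\` g)%mset)) (size (enum_mset (z' `\` g)%mset)).

Definition enat (n : nat) : \bar RR := (n%:R)%:E.

(* [ereal_inf] of an empty set is [+oo]; every other set of natural numbers
   attains its infimum. *)
Definition minL a : \bar RR := ereal_inf [set enat n | n in Lset a].
Definition supL a : \bar RR := ereal_sup [set enat n | n in Lset a].

Definition Lambda : \bar RR := ereal_sup [set minL a | a in [set: H]].
Definition rho_ k : \bar RR := ereal_sup [set supL a | a in [set a | Lset a k]].
Definition rho : \bar RR :=
  ereal_sup [set x | exists a m n, [/\ nonunits H a, Lset a m, Lset a n
                                     & x = ((m%:R / n%:R)%R)%:E]].

Definition tame u : \bar RR :=
  ereal_inf [set enat N | N in [set N : nat |
    forall a z, Zfact a `&` Zmul [mset u]%mset !=set0 -> Zfact a z ->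
      exists z', [/\ Zfact a z', Zmul [mset u]%mset z' & (Zdist z z' <= N)%N]]].

Definition globally_tame : Prop :=
  (ereal_sup [set tame u | u in [set: set_type (atoms (Hred H))]] < +oo)%E.

End Factorizations.

Arguments Lambda H : clear implicits.
Arguments rho_ H k : clear implicits.
Arguments rho H : clear implicits.
Arguments globally_tame H : clear implicits.

Section QuotientGroup.
Variable H : cmonoidType.
Implicit Types a b c d : H.

Definition qrel (x y : H * H) : bool := x.1 * y.2 == y.1 * x.2.

Lemma qrel_refl : reflexive qrel. Proof. by move=> x; apply: eqxx. Qed.

Lemma qrel_sym : symmetric qrel. Proof. by move=> x y; apply: eq_sym. Qed.

Lemma qrel_trans : transitive qrel.
Proof.
move=> y x z /eqP xy /eqP yz; apply/eqP/(@cmulI _ y.2).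
by rewrite [LHS]cmulCA cmulA xy -cmulA (cmulC x.2) cmulA yz -cmulA cmulCA.
Qed.

Canonical qrel_equiv := EquivRel qrel qrel_refl qrel_sym qrel_trans.

(* The quotient group [q(H)]: the class of [(a, b)] is the fraction [a / b]. *)
Definition qgroup := {eq_quot qrel}.
HB.instance Definition _ : EqQuotient _ qrel qgroup := EqQuotient.on qgroup.
HB.instance Definition _ := Choice.on qgroup.

Definition toq a : qgroup := \pi_qgroup (a, 1).
Definition q_one : qgroup := \pi_qgroup (1, 1).
Definition q_mul := lift_op2 qgroup (fun x y : H * H => (x.1 * y.1, x.2 * y.2)).
Definition q_inv := lift_op1 qgroup (fun x : H * H => (x.2, x.1)).

Lemma qrelP (x y : H * H) :
  reflect (x = y %[mod qgroup]) (x.1 * y.2 == y.1 * x.2).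
Proof. by apply: (iffP idP) => [h|/eqmodP//]; apply/eqmodP. Qed.

Lemma qrel_repr (x : H * H) :
  x.1 * (repr (\pi_qgroup x)).2 = (repr (\pi_qgroup x)).1 * x.2.
Proof. by apply/eqP/qrelP; rewrite reprK. Qed.

Lemma pi_q_mul :
  {morph \pi_qgroup : x y / (x.1 * y.1, x.2 * y.2) : H * H >-> q_mul x y}.
Proof.
move=> x y; unlock q_mul; apply/qrelP => /=.
by rewrite cmulACA !qrel_repr cmulACA.
Qed.
Canonical pi_q_mul_morph := PiMorph2 pi_q_mul.

Lemma pi_q_inv : {morph \pi_qgroup : x / (x.2, x.1) : H * H >-> q_inv x}.
Proof.
move=> x; unlock q_inv; apply/qrelP => /=.
by rewrite cmulC -qrel_repr cmulC.
Qed.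
Canonical pi_q_inv_morph := PiMorph1 pi_q_inv.

Lemma q_mulA : associative q_mul.
Proof.
by elim/quotW=> x; elim/quotW=> y; elim/quotW=> z; rewrite !piE /= !cmulA.
Qed.

Lemma q_mulC : commutative q_mul.
Proof.
elim/quotW=> x; elim/quotW=> y; rewrite !piE.
by rewrite (cmulC x.1) (cmulC x.2).
Qed.

Lemma q_mul1g : left_id q_one q_mul.
Proof. by elim/quotW=> -[a b]; rewrite /q_one !piE /= !mul1g. Qed.

Lemma q_mulg1 : right_id q_one q_mul.
Proof. by move=> x; rewrite q_mulC q_mul1g. Qed.

Lemma q_mulVg : left_inverse q_one q_inv q_mul.
Proof.
elim/quotW=> x; rewrite /q_one !piE /=; apply/qrelP => /=.
by rewrite mulg1 mul1g cmulC.
Qed.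

Lemma q_mulgV : right_inverse q_one q_inv q_mul.
Proof. by move=> x; rewrite q_mulC q_mulVg. Qed.

HB.instance Definition _ :=
  isGroup.Build qgroup q_mulA q_mul1g q_mulg1 q_mulVg q_mulgV.

Lemma q_mulI (x : qgroup) : injective (monoid.mul x).
Proof. by move=> y z; apply: mulgI. Qed.

HB.instance Definition _ :=
  Monoid_isCancelCommutative.Build qgroup q_mulC q_mulI.

Lemma toqM a b : toq (a * b) = toq a * toq b.
Proof. by rewrite /toq [RHS]piE /= mulg1. Qed.

Lemma toq1 : toq 1 = 1. Proof. by []. Qed.

End QuotientGroup.

Section CompleteIntegralClosure.
Variable H : cmonoidType.
Implicit Types X Y : set (qgroup H).

Definition inq : set (qgroup H) := range (@toq H).

Definition cic : set (qgroup H) :=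
  [set x | exists c : H, forall n : nat, (0 < n)%N -> inq (toq c * x ^+ n)].

Definition colon X Y : set (qgroup H) :=
  [set z | forall y, Y y -> X (z * y)].

Definition dil (x : qgroup H) X : set (qgroup H) := [set x * y | y in X].

Lemma cic_closed : monoid_closed (fun x => x \in cic).
Proof.
split=> [|x y].
  by rewrite inE; exists 1 => n _; exists 1 => //; rewrite toq1 expg1n mulg1.
rewrite unfold_in inE => -[c cx]; rewrite unfold_in inE => -[d dy].
rewrite unfold_in inE; exists (c * d) => n n0.
have [[r _ re] [s _ se]] := (cx _ n0, dy _ n0).
by exists (r * s) => //; rewrite !toqM cexpM cmulACA re se.
Qed.

Definition cicm := {x : qgroup H | x \in cic}.
HB.instance Definition _ := SubChoice.on cicm.
HB.instance Definition _ :=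
  SubChoice_isSubMonoid.Build (qgroup H) (fun x => x \in cic) cicm cic_closed.

Lemma cicm_mulC : @commutative cicm cicm monoid.mul.
Proof. by move=> x y; apply: val_inj; rewrite !valM cmulC. Qed.

Lemma cicm_mulI (x : cicm) : injective (monoid.mul x).
Proof. by move=> y z /(congr1 val); rewrite !valM => /cmulI/val_inj. Qed.

HB.instance Definition _ :=
  Monoid_isCancelCommutative.Build cicm cicm_mulC cicm_mulI.
End CompleteIntegralClosure.

Arguments inq H : clear implicits.
Arguments cic H : clear implicits.
Arguments cicm H : clear implicits.

Section NonzeroMonoid.
Variable R : idomainType.
Local Open Scope ring_scope.

Definition nz := {x : R | x != 0}.
HB.instance Definition _ := SubChoice.on nz.
Implicit Types x y : nz.

Definition nz_one : nz := exist _ (1 : R) (oner_neq0 R).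

Fact nz_mul_subproof x y : val x * val y != 0.
Proof. by rewrite mulf_neq0 ?(valP x) ?(valP y). Qed.

Definition nz_mul x y : nz := exist _ (val x * val y) (nz_mul_subproof x y).

Lemma nz_mulA : associative nz_mul.
Proof. by move=> x y z; apply: val_inj => /=; rewrite mulrA. Qed.

Lemma nz_mul1 : left_id nz_one nz_mul.
Proof. by move=> x; apply: val_inj => /=; rewrite mul1r. Qed.

Lemma nz_mulr1 : right_id nz_one nz_mul.
Proof. by move=> x; apply: val_inj => /=; rewrite mulr1. Qed.

HB.instance Definition _ := isMonoid.Build nz nz_mulA nz_mul1 nz_mulr1.

Lemma nz_mulC : @commutative nz nz monoid.mul.
Proof. by move=> x y; apply: val_inj => /=; rewrite mulrC. Qed.

Lemma nz_mulI x : injective (monoid.mul x).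
Proof.
by move=> y z /(congr1 val) /= /(mulfI (valP x)) yz; apply: val_inj.
Qed.

HB.instance Definition _ :=
  Monoid_isCancelCommutative.Build nz nz_mulC nz_mulI.

Lemma val_nzM x y : val (x * y)%g = val x * val y. Proof. by []. Qed.

End NonzeroMonoid.

Section DomainClosure.
Variable R : idomainType.
Local Open Scope ring_scope.
Local Notation K := {fraction R}.
Local Notation "x %:F" := (@FracField.tofrac R x).

(* The canonical isomorphism from [q(R \ {0})] onto [K \ {0}]. *)
Definition qfrac (x : qgroup (nz R)) : K :=
  (val (repr x).1)%:F / (val (repr x).2)%:F.

Definition ciR : set K := [set 0] `|` qfrac @` cic (nz R).

Lemma nzF_neq0 (a : nz R) : (val a)%:F != 0.
Proof. by rewrite tofrac_eq0 (valP a). Qed.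

Lemma qfrac_pi (a b : nz R) :
  qfrac (\pi_(qgroup (nz R)) (a, b)) = (val a)%:F / (val b)%:F.
Proof.
rewrite /qfrac; have /= := qrel_repr (a, b).
case: (repr _) => c d /= /(congr1 val); rewrite !val_nzM => e.
apply/eqP; rewrite eqr_div ?nzF_neq0// -!tofracM -e.
by rewrite eqxx.
Qed.

Lemma qfrac_toq (a : nz R) : qfrac (toq a) = (val a)%:F.
Proof. by rewrite qfrac_pi /= tofrac1 divr1. Qed.

Lemma qfracM x y : qfrac (x * y)%g = qfrac x * qfrac y.
Proof.
elim/quotW: x => -[a b]; elim/quotW: y => -[c d].
rewrite [(_ * _)%g]piE !qfrac_pi /= !tofracM.
by rewrite mulf_div.
Qed.

Lemma qfrac1 : qfrac 1%g = 1.
Proof. by rewrite -(toq1 (nz R)) qfrac_toq tofrac1. Qed.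

Lemma qfracX x n : qfrac (x ^+ n)%g = qfrac x ^+ n.
Proof. by elim: n => [|n IHn]; rewrite ?qfrac1// expgS qfracM IHn exprS. Qed.

Lemma qfrac_inj : injective qfrac.
Proof.
elim/quotW=> -[a b]; elim/quotW=> -[c d]; rewrite !qfrac_pi => /eqP.
rewrite eqr_div ?nzF_neq0// -!tofracM tofrac_eq => /eqP e.
by apply/qrelP/eqP/val_inj.
Qed.

Lemma fracE (x : K) : exists a b : R, b != 0 /\ x = a%:F / b%:F.
Proof.
elim/quotW: x => r; exists \n_r, \d_r; rewrite denom_ratioP; split=> //.
apply/eqP; rewrite eq_sym -(inj_eq (mulIf (x := (\d_r)%:F) _)).
  rewrite divfK ?tofrac_eq0 ?denom_ratioP// eq_sym.
  unlock FracField.tofrac; rewrite -[X in X == _]FracField.pi_mul.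
  apply/eqP/eqmodP; rewrite /= FracField.equivfE /FracField.mulf.
  by rewrite !numden_Ratio ?mulf_neq0 ?oner_neq0 ?denom_ratioP// !mulr1 mulrC.
by rewrite tofrac_eq0 denom_ratioP.
Qed.

Lemma ciRP (x : K) :
  ciR x <-> exists2 c : R, c != 0 & forall n, exists r, c%:F * x ^+ n = r%:F.
Proof.
split=> [[->|[y [c yc] <-]]|[c c0 xc]].
- exists 1; rewrite ?oner_neq0// => n; exists (0 ^+ n).
  by rewrite tofrac1 mul1r tofracXn tofrac0.
- exists (val c); first exact: (valP c).
  case=> [|n]; first by exists (val c); rewrite mulr1.
  have [//|r _ e] := yc n.+1; exists (val r).
  by rewrite -qfracX -!qfrac_toq -qfracM e.
have [->|x0] := eqVneq x 0; [by left|right].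
have [y yx] : exists y, qfrac y = x.
  have [a [b [b0 ab]]] := fracE x.
  have a0 : a != 0.
    by apply: contraNneq x0 => a0; rewrite ab a0 tofrac0 mul0r.
  exists (\pi_(qgroup (nz R)) (exist _ a a0, exist _ b b0)).
  by rewrite qfrac_pi /= -ab.
exists y => //; exists (exist _ c c0) => n _; have [r e] := xc n.
have r0 : r != 0.
  by rewrite -tofrac_eq0 -e mulf_neq0 ?tofrac_eq0// expf_neq0.
exists (exist _ r r0) => //; apply: qfrac_inj.
by rewrite qfracM qfracX !qfrac_toq /= yx e.
Qed.

Definition ci_dom := {x : K | x \in ciR}.

Lemma ciR_subring : subring_closed (fun x => x \in ciR).
Proof.
split=> [|x y|x y].
- rewrite unfold_in inE; apply/ciRP; exists 1; rewrite ?oner_neq0// => n.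
  by exists 1; rewrite expr1n mulr1.
- rewrite !unfold_in !inE => /ciRP[c c0 cx] /ciRP[d d0 dy]; apply/ciRP.
  have [f fE] := choice cx; have [g gE] := choice dy.
  exists (c * d); first by rewrite mulf_neq0.
  move=> n; exists (\sum_(i < n.+1) ((-1) ^+ i * f (n - i)%N * g i) *+ 'C(n, i)).
  rewrite exprBn mulr_sumr raddf_sum; apply: eq_bigr => i _.
  rewrite [RHS]tofracMn mulrnAr !tofracM -fE -gE tofracXn tofracN tofrac1.
  congr (_ *+ _); have e (p q s t u : K) :
    p * q * (s * t * u) = s * (p * t) * (q * u).
    by rewrite -[RHS]mulrA (mulrACA p t) [RHS]mulrCA !mulrA.
  exact: e.
- rewrite !unfold_in !inE => /ciRP[c c0 cx] /ciRP[d d0 dy]; apply/ciRP.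
  exists (c * d) => [|n]; first by rewrite mulf_neq0.
  have [[r rE] [s sE]] := (cx n, dy n).
  by exists (r * s); rewrite !tofracM exprMn mulrACA rE sE.
Qed.

HB.instance Definition _ := SubChoice.on ci_dom.
HB.instance Definition _ :=
  GRing.SubChoice_isSubComNzRing.Build K (fun x => x \in ciR) ci_dom ciR_subring.

Definition ci_unit : {pred ci_dom} := fun x => `[< exists y : ci_dom, y * x = 1 >].
Definition ci_inv (x : ci_dom) : ci_dom :=
  if pselect (exists y : ci_dom, y * x = 1) is left e then projT1 (cid e) else x.

Lemma ci_mulV : {in ci_unit, left_inverse 1 ci_inv *%R}.
Proof.
move=> x /asboolP e; rewrite /ci_inv; case: pselect => // e'.
by case: (cid e').
Qed.

Lemma ci_unitP (x y : ci_dom) : y * x = 1 -> ci_unit x.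
Proof. by move=> yx; apply/asboolP; exists y. Qed.

Lemma ci_inv_out : {in [predC ci_unit], ci_inv =1 id}.
Proof. by move=> x /asboolP e; rewrite /ci_inv; case: pselect. Qed.

HB.instance Definition _ :=
  GRing.ComNzRing_hasMulInverse.Build ci_dom ci_mulV ci_unitP ci_inv_out.

Lemma ci_mulf_eq0 : GRing.integral_domain_axiom ci_dom.
Proof.
move=> x y /(congr1 val); rewrite rmorphM rmorph0 => /eqP.
by rewrite mulf_eq0 => /orP[] /eqP h; apply/orP; [left|right];
   apply/eqP/val_inj; rewrite rmorph0.
Qed.

HB.instance Definition _ :=
  GRing.ComUnitRing_isIntegral.Build ci_dom ci_mulf_eq0.

Implicit Types X Y : set K.

Definition inK (X : set R) : set K := (@FracField.tofrac R) @` X.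
Definition colonK X Y : set K := [set z | forall y, Y y -> X (z * y)].
(* Elementwise products: an ideal contains [setmulK I J] if and only if it
   contains the ideal product of [I] and [J]. *)
Definition setmulK X Y : set K := [set x * y | x in X & y in Y].

Definition dilK (x : K) X : set K := [set x * y | y in X].

(* [idealr_closed] includes properness. *)
Definition local_with (M : set R) : Prop :=
  let maximal (I : set R) := idealr_closed (fun x => x \in I) /\
    forall J : set R, idealr_closed (fun x => x \in J) -> I `<=` J -> J = I in
  maximal M /\ forall I, maximal I -> I = M.

End DomainClosure.

Arguments ciR R : clear implicits.
Arguments ci_dom R : clear implicits.

Definition strongly_primary_domain (R : idomainType) := strongly_primary (nz R).
Definition primary_domain (R : idomainType) := primary (nz R).
Definition valuation_domain (R : idomainType) := valuation (nz R).
Definition globally_tame_domain (R : idomainType) := globally_tame (nz R).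

(* Main.v *)
Require Import Defs.
From HB Require Import structures.
From mathcomp Require Import all_boot all_order all_algebra.
From mathcomp Require Import finmap multiset.
From mathcomp Require Import zify ring.
From mathcomp Require Import all_classical all_reals.
From mathcomp Require Import ereal Rstruct.

Set Implicit Arguments.
Unset Strict Implicit.
Unset Printing Implicit Defensive.

Import Order.TTheory GRing.Theory Num.Theory.

(** In a strongly primary monoid a long product of nonunits is divisible by
    any prescribed nonunit [d], so an element not divisible by [d] has only
    factorizations of bounded length ([long_factorizations_dvd],
    [undivided_len_bounded]).

    Let [c] be a common multiple of all atoms.  Then a product of [k] atoms
    divides [c ^+ k], while [c] divides every long enough factorization.
    Comparing the two bounds one factorization length linearly by another, which
    is finite elasticity, and it bounds the tame degrees: to bring a prescribed
    atom into a factorization it is enough to rewrite a subproduct of bounded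
    length.  Conversely, under global tameness an atom dividing some power of a
    fixed atom [v] already divides a power with bounded exponent, so a fixed
    power of [v] is a common multiple of the atoms.

    The core is what unbounded minimal lengths imply.  Fix nonunits [b] and [d].
    Every element is [b ^+ k * c] with [c] not divisible by [b]; if all large
    powers of [b] were products of two elements not divisible by [d], minimal
    lengths would be bounded.  Hence some arbitrarily large powers of [b] are unsplittable: in
    each decomposition into two factors one factor is divisible by [d]
    ([unsplittable_power]).  This is used twice.

    - In the quotient group, for any [x], the products
      [(x ^+ i * b ^+ j) * (x ^- i * b ^+ (N - j))] are tentative splittings of
      a power of [b].  Unsplittability controls them by induction on [i] and
      yields a common denominator for the powers of [x] or for those of
      [x^-1] ([powers_balanced]).  So the complete integral closure is a
      valuation monoid.

    - In a domain, let [x ^+ 2] be in [b R] and [b ^+ M * x] in [R].  Then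
      [1 - x ^+ 2] is a unit, so [b ^+ M * (1 + x)] and [b ^+ M * (1 - x)]
      split [b ^+ (2 * M)] up to a unit ([unsplittable_square]).  Unsplittability makes the denominators of
      such [x] uniformly bounded.  Taking square roots repeatedly, a fixed power
      of [b] multiplies the whole complete integral closure into [R]
      ([square_root_conductor]).  So for domains unbounded minimal lengths force
      a nonzero conductor.

    When the conductor [f] is nonempty and the closure is a valuation monoid,
    take [x] in [f], a nonunit [a] and an atom [u].  Either [u] divides [x a] in
    the closure, or [u = a (x t)] with [t] in the closure and [x t] in the
    monoid, so [x t] is a unit and again [u] divides [x a].  A second factor
    from [f] moves the quotient into the monoid, which gives a common multiple
    of the atoms.

    The domain statement is the monoid statement for the nonzero elements,
    carried through the isomorphism from their quotient group onto the nonzero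
    elements of the fraction field, with zero added to every set ([lift0]). *)

(** * Divisibility and associate classes *)

Section Divisibility.
Variable H : cmonoidType.
Implicit Types a b c d : H.
Local Open Scope group_scope.

Lemma dvdm_refl a : dvdm a a. Proof. by exists 1; rewrite mulg1. Qed.

Lemma dvdm_trans b a c : dvdm a b -> dvdm b c -> dvdm a c.
Proof. by move=> [x ->] [y ->]; exists (x * y); rewrite cmulA. Qed.

Lemma dvdm_mulr a b : dvdm a (a * b). Proof. by exists b. Qed.

Lemma dvdm_mull a b : dvdm a (b * a). Proof. by exists b; rewrite cmulC. Qed.

Lemma dvdmM a b c d : dvdm a b -> dvdm c d -> dvdm (a * c) (b * d).
Proof. by move=> [x ->] [y ->]; exists (x * y); rewrite cmulACA. Qed.

Lemma dvdm_exp2l a m n : (m <= n)%N -> dvdm (a ^+ m) (a ^+ n).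
Proof. by move=> /subnKC <-; rewrite expgnDr; apply: dvdm_mulr. Qed.

Lemma dvd1m a : dvdm 1 a. Proof. by exists a; rewrite mul1g. Qed.

Lemma dvdm_unit a b : dvdm a b -> units H b -> units H a.
Proof. by move=> [x ->] [y xy]; exists (x * y); rewrite cmulA. Qed.

Lemma nonunits_dvd a b : dvdm a b -> nonunits H a -> nonunits H b.
Proof. by move=> ab na ub; apply/na/(dvdm_unit ab). Qed.

(** Cancelling [a] would make [b] divide [1]; nearly every length bound below
    is obtained from this contradiction. *)
Lemma nonunits_ndvd a b : nonunits H b -> ~ dvdm (a * b) a.
Proof.
move=> nb [x]; rewrite -[LHS]mulg1 -cmulA => /cmulI bx.
by apply: nb; exists x.
Qed.

Local Notation cl := (\pi_(Hred H)%qT).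

Lemma class_surj (x : Hred H) : exists a, cl a = x.
Proof. by elim/quotW: x => a; exists a. Qed.

Lemma classM a b : cl (a * b) = cl a * cl b. Proof. exact: pi_red_mul. Qed.

Lemma classX a n : cl (a ^+ n) = cl a ^+ n.
Proof. by elim: n => [|n IHn] //; rewrite !expgS classM IHn. Qed.

Lemma class_eq a b : cl a = cl b -> exists2 e, units H e & b = a * e.
Proof. by move=> /eqmodP/asboolP. Qed.

Lemma dvdm_class a b : dvdm (cl a) (cl b) <-> dvdm a b.
Proof.
split=> [[x]|[x ->]]; last by exists (cl x); rewrite classM.
have [c <-] := class_surj x; rewrite -classM => /class_eq[e [f ef]].
move=> ac; exists (c * f); rewrite cmulA ac -cmulA ef mulg1 //.
Qed.

Lemma units_class a : units (Hred H) (cl a) <-> units H a.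
Proof.
split=> [[x ax]|[b ab]]; last by exists (cl b); rewrite -classM ab.
suff [c ac] : dvdm a 1 by exists c.
by apply/dvdm_class; exists x; rewrite ax.
Qed.

Lemma units_class1 a : units H a <-> cl a = 1.
Proof.
split=> [[b ab]|ea]; last by apply/units_class; rewrite ea; exists 1; rewrite mulg1.
by symmetry; apply/eqmodP/asboolP; exists a; [exists b|rewrite mul1g].
Qed.

Lemma atoms_class a : atoms (Hred H) (cl a) <-> atoms H a.
Proof.
split=> -[na ia]; split.
- by move=> ua; apply/na/units_class.
- move=> b c abc; have := ia (cl b) (cl c); rewrite -classM abc => /(_ erefl).
  by case=> /units_class; [left|right].
- by move=> /units_class.
- move=> x y; have [b <-] := class_surj x; have [c <-] := class_surj y.
  rewrite -classM => /esym/class_eq[e [f ef] abce].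
  have /ia[/units_class|] : a = b * (c * e) by rewrite cmulA.
  + by left.
  + by move=> uce; right; apply/units_class; apply: dvdm_unit uce; apply: dvdm_mulr.
Qed.

End Divisibility.

HB.instance Definition _ (H : cmonoidType) :=
  SemiGroup.isCommutativeLaw.Build H monoid.mul (@cmulC H).

(** * Factorizations and their lengths *)

Section Lengths.
Variable H : cmonoidType.
Implicit Types (a b d : H) (z : Zmon H).
Local Open Scope group_scope.
Local Notation cl := (\pi_(Hred H)%qT).
Local Notation len z := (size (enum_mset z)).

Lemma perm_msetD z z' :
  perm_eq (enum_mset (z `+` z')%mset) (enum_mset z ++ enum_mset z').
Proof. by apply/allP => u _ /=; rewrite count_cat !count_mem_mset msetE2. Qed.

Lemma len_msetD z z' : len (z `+` z')%mset = (len z + len z')%N.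
Proof. by rewrite (perm_size (perm_msetD z z')) size_cat. Qed.

Lemma ZpiD z z' : Zpi (z `+` z')%mset = Zpi z * Zpi z'.
Proof. by rewrite /Zpi (perm_big _ (perm_msetD z z')) big_cat. Qed.

Lemma Zpi0 : Zpi (mset0 : Zmon H) = 1.
Proof. by rewrite /Zpi big_mset0. Qed.

Lemma Zpi1 u : Zpi ([mset u]%mset : Zmon H) = val u.
Proof. by rewrite /Zpi enum_msetn big_seq1. Qed.

Lemma msubset_decomp z z' : (z `<=` z')%mset -> exists y, z' = (z `+` y)%mset.
Proof. by move=> /msetBDKC <-; exists (z' `\` z)%mset. Qed.

Lemma Zmon_split z n : (n <= len z)%N ->
  exists x y : Zmon H, z = (x `+` y)%mset /\ len x = n.
Proof.
move=> nz; exists (seq_mset (take n (enum_mset z))).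
exists (seq_mset (drop n (enum_mset z))); split.
  apply/msetP => u; rewrite msetE2 !mset_seqE -count_cat cat_take_drop.
  by rewrite count_mem_mset.
by rewrite (perm_size (perm_eq_seq_mset _)) size_takel.
Qed.

(** The common part [y] cancels in the distance, so replacing a factor [x] of a
    factorization costs at most the lengths of [x] and of its replacement. *)
Lemma Zdist_leq y x x' :
  (Zdist (x `+` y : Zmon H) (x' `+` y) <= maxn (len x) (len x'))%mset%N.
Proof.
rewrite /Zdist.
suff main (t t' : Zmon H) :
    (len ((t `+` y) `\` ((t `+` y) `&` (t' `+` y)))%mset <= len t)%N.
  rewrite geq_max !leq_max main /= msetIC main orbT //.
have /msubset_decomp[w tE] : ((t `+` y) `\` ((t `+` y) `&` (t' `+` y)) `<=` t)%mset.
  by apply/msubsetP => u; rewrite !msetE2; lia.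
by rewrite [in leqRHS]tE len_msetD leq_addr.
Qed.

Lemma Zpi_constant z v : (forall u, u \in z -> u = v) -> Zpi z = val v ^+ len z.
Proof.
move=> zv; rewrite /Zpi big_seq (eq_bigr (fun=> val v)) => [|u uz]; last first.
  by rewrite (zv u).
by rewrite -big_seq big_const_seq count_predT iter_mulg mulg1.
Qed.

Lemma Zpi_unit z : units (Hred H) (Zpi z) -> len z = 0%N.
Proof.
have [-> _|[u uz]] := mset_0Vmem z; first by rewrite size_mset0.
have /msubset_decomp[y ->] : ([mset u] `<=` z)%mset by rewrite msub1set.
rewrite ZpiD Zpi1 => /(dvdm_unit (dvdm_mulr _ _)) uu.
by case: (set_valP u) => /(_ uu).
Qed.

End Lengths.

(** * Lengths in strongly primary monoids *)

Section StronglyPrimary.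
Variable H : cmonoidType.
Hypothesis spH : strongly_primary H.
Implicit Types (a b d : H) (z : Zmon H).
Local Open Scope group_scope.
Local Notation cl := (\pi_(Hred H)%qT).
Local Notation len z := (size (enum_mset z)).

Lemma exists_nonunit : exists b, nonunits H b.
Proof.
apply: contrapT => nex; apply: spH.1; apply/seteqP; split=> // b _.
by apply: contrapT => nb; apply: nex; exists b.
Qed.

Lemma setexp_prod s : (forall x, x \in s -> nonunits H x) ->
  setexp (nonunits H) (size s) (\prod_(x <- s) x).
Proof.
elim: s => [|x s IHs] sn; first by rewrite big_nil.
rewrite big_cons; exists x; first by apply: sn; rewrite mem_head.
exists (\prod_(y <- s) y) => //; apply: IHs => y ys.
by apply: sn; rewrite inE ys orbT.
Qed.

Lemma long_products_dvd d : nonunits H d ->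
  exists B : nat, forall s, (forall x, x \in s -> nonunits H x) ->
    (B <= size s)%N -> dvdm d (\prod_(x <- s) x).
Proof.
move=> /spH.2[B [_ mB]]; exists B => s sn Bs.
rewrite -(cat_take_drop B s) big_cat /=.
have [|c _ <-] := mB (\prod_(x <- take B s) x).
  have sB : size (take B s) = B by rewrite size_takel.
  by rewrite -{1}sB; apply: setexp_prod => x /mem_take/sn.
by rewrite -cmulA; apply: dvdm_mulr.
Qed.

(** A product of too many nonunits is divisible by [a * b] with [b] a nonunit,
    which cannot divide [a]. *)
Lemma nonunit_products_bounded a : exists B : nat, forall s,
  (forall x, x \in s -> nonunits H x) -> dvdm (\prod_(x <- s) x) a ->
  (size s < B)%N.
Proof.
have [b nb] := exists_nonunit.
have [B mB] := long_products_dvd (nonunits_dvd (dvdm_mull b a) nb).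
exists B => s /mB sB sa; rewrite ltnNge; apply/negP => /sB abs.
exact: nonunits_ndvd nb (dvdm_trans abs sa).
Qed.

Lemma nonunit_power_bounded a b : nonunits H b -> exists n, ~ dvdm (b ^+ n) a.
Proof.
move=> nb; have [B aB] := nonunit_products_bounded a.
exists B; have := aB (nseq B b); rewrite big_nseq iter_mulg mulg1 size_nseq.
move=> bB bBa; suff nbs x : x \in nseq B b -> nonunits H x.
  by have := bB nbs bBa; rewrite ltnn.
by rewrite mem_nseq => /andP[_ /eqP->].
Qed.

Lemma primary_of_strongly_primary a b : nonunits H a -> nonunits H b ->
  exists2 n : nat, (0 < n)%N & dvdm a (b ^+ n).
Proof.
move=> /long_products_dvd[B aB] nb; exists B.+1 => //.
have := aB (nseq B.+1 b); rewrite big_nseq iter_mulg mulg1 size_nseq.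
by apply=> // x; rewrite mem_nseq => /andP[_ /eqP->].
Qed.

(** Splitting a nonunit that is not an atom lowers the bound on the number of
    nonunit factors, so the induction runs on that bound. *)
Lemma factorization_exists x : exists z, Zpi z = x.
Proof.
have [a <-{x}] := class_surj x.
have [B aB] := nonunit_products_bounded a; elim: B a aB => [|B IHB] a aB.
  by suff: (0 < 0)%N; [|apply: (aB [::]); rewrite ?big_nil//; apply: dvd1m].
have [/units_class1 ->|na] := pselect (units H a).
  by exists mset0; rewrite Zpi0.
have [aa|/not_andP[//|/existsNP[b /existsNP[c /not_implyP[abc]]]]] :=
  pselect (atoms H a).
  have Aa : cl a \in atoms (Hred H) by apply/mem_set/atoms_class.
  by exists [mset (SigSub Aa)]%mset; rewrite Zpi1.
move=> /not_orP[nb nc].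
suff step y y' : a = y * y' -> nonunits H y' -> exists z, Zpi z = cl y.
  have [z zb] := step b c abc nc; have [z' zc] : exists z, Zpi z = cl c.
    by apply: step nb; rewrite abc cmulC.
  by exists (z `+` z')%mset; rewrite ZpiD zb zc abc classM.
move=> ayy ny'; apply: IHB => s sn sy.
have := aB (y' :: s); rewrite /= ltnS big_cons; apply=> [t|].
  by rewrite inE => /predU1P[->//|/sn].
by rewrite ayy cmulC; apply: dvdmM sy (dvdm_refl _).
Qed.

Lemma atom_exists : exists v : set_type (atoms (Hred H)), True.
Proof.
have [b nb] := exists_nonunit; have [z zb] := factorization_exists (cl b).
have [z0|[u _]] := mset_0Vmem z; last by exists u.
by case: nb; apply/units_class1; rewrite -zb z0 Zpi0.
Qed.

Lemma long_factorizations_dvd d : nonunits H d ->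
  exists B : nat, forall z, (B <= len z)%N -> dvdm (cl d) (Zpi z).
Proof.
move=> /long_products_dvd[B dB]; exists B => z Bz.
pose r (u : set_type (atoms (Hred H))) : H := repr (val u).
have -> : Zpi z = cl (\prod_(x <- map r (enum_mset z)) x).
  rewrite big_map (big_morph cl (@classM H) (erefl : cl 1 = 1)).
  by apply: eq_bigr => u _; rewrite reprK.
apply/dvdm_class/dB; last by rewrite size_map.
move=> x /mapP[u _ ->]; suff [] : atoms H (r u) by [].
by apply/atoms_class; rewrite reprK; apply: set_valP.
Qed.

Lemma undivided_len_bounded d : nonunits H d ->
  exists B : nat, forall a z, ~ dvdm d a -> Zpi z = cl a -> (len z < B)%N.
Proof.
move=> /long_factorizations_dvd[B dB]; exists B => a z nda za.
by rewrite ltnNge; apply/negP => /dB; rewrite za => /dvdm_class.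
Qed.

(** Exists because only boundedly many powers of [b] divide [a]. *)
Lemma max_power a b : nonunits H b ->
  exists k c, a = b ^+ k * c /\ ~ dvdm b c.
Proof.
move=> nb; have [n] := nonunit_power_bounded a nb.
elim: n a => [|n IHn] a an; first by case: an; apply: dvd1m.
have [[a' ae]|nba] := pselect (dvdm b a); last first.
  by exists 0%N, a; rewrite mul1g.
have [|k [c [a'e nbc]]] := IHn a'.
  by move=> ba'; apply: an; rewrite expgS ae; apply: dvdmM ba'; apply: dvdm_refl.
by exists k.+1, c; rewrite ae a'e expgS cmulA.
Qed.

End StronglyPrimary.

(** * The arithmetical invariants as bounds on natural numbers *)

Section Finiteness.
Variable H : cmonoidType.
Implicit Types (a b : H) (z : Zmon H).
Local Open Scope classical_set_scope.
Local Open Scope group_scope.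
Local Notation cl := (\pi_(Hred H)%qT).
Local Notation len z := (size (enum_mset z)).

Lemma lee_enat m n : (enat m <= enat n)%E = (m <= n)%N.
Proof. by rewrite /enat lee_fin ler_nat. Qed.

Lemma lte_enat m n : (enat m < enat n)%E = (m < n)%N.
Proof. by rewrite /enat lte_fin ltr_nat. Qed.

Lemma enat_bound (x : \bar Rdefinitions.R) :
  (x < +oo)%E -> exists N, (x <= enat N)%E.
Proof.
case: x => [r _|//|_]; last by exists 0%N; apply: leNye.
by exists (Num.truncn r).+1; rewrite lee_fin; apply/ltW/truncnS_gt.
Qed.

(** A supremum below [+oo] is a real number, hence below some natural number;
    this turns each of the suprema of lengths into a uniform bound. *)
Lemma sup_enatP (T : Type) (D : set T) (f : T -> \bar Rdefinitions.R) :
  (ereal_sup [set f t | t in D] < +oo)%E <->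
  exists N, forall t, D t -> (f t <= enat N)%E.
Proof.
split=> [/enat_bound[N supN]|[N fN]].
  by exists N => t Dt; apply: le_trans supN; apply: ereal_sup_ubound; exists t.
apply: (@le_lt_trans _ _ (enat N)); last exact: ltry.
by apply: ge_ereal_sup => _ [t Dt <-]; apply: fN.
Qed.

(** An infimum of natural numbers is attained.  On the empty set both sides
    fail, since the infimum is [+oo]. *)
Lemma inf_enat_le (A : set nat) N :
  (ereal_inf [set enat n | n in A] <= enat N)%E <-> exists2 n, A n & (n <= N)%N.
Proof.
split=> [AN|[n An nN]].
  have /ereal_inf_lt[_ [n An <-]] : (ereal_inf [set enat n | n in A] < enat N.+1)%E.
    by apply: le_lt_trans AN _; rewrite lte_enat.
  by rewrite lte_enat; exists n.
apply: (@le_trans _ _ (enat n)); last by rewrite lee_enat.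
by apply: ereal_inf_lbound; exists n.
Qed.

Lemma globally_tameP : globally_tame H <-> exists N : nat, forall u a z,
  Zfact a `&` Zmul [mset u]%mset !=set0 -> Zfact a z ->
  exists z', [/\ Zfact a z', Zmul [mset u]%mset z' & (Zdist z z' <= N)%N].
Proof.
split=> [/sup_enatP[N tN]|[N tN]].
  exists N => u a z ua za; have /inf_enat_le[n tn nN] := tN u I.
  have [z' [z'a uz' zz']] := tn a z ua za.
  by exists z'; split=> //; apply: leq_trans nN.
by apply/sup_enatP; exists N => u _; apply/inf_enat_le; exists N => //; apply: tN.
Qed.

Lemma rho_kP k : (rho_ H k < +oo)%E <-> exists N : nat, forall z z',
  Zpi z = Zpi z' -> len z = k -> (len z' <= N)%N.
Proof.
split=> [/sup_enatP[N kN]|[N kN]].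
  exists N => z z' zz' zk; have [a za] := class_surj (Zpi z).
  rewrite -lee_enat; apply: le_trans (kN a _); last by exists z.
  apply: ereal_sup_ubound; exists (len z') => //; exists z' => //.
  by rewrite /Zfact /= -zz'.
apply/sup_enatP; exists N => a [z za zk].
apply: ge_ereal_sup => _ [_ [z' z'a <-] <-].
by rewrite lee_enat; apply: kN zk; rewrite za.
Qed.

(** Clearing the denominator also covers units, whose only factorization is
    empty. *)
Lemma rhoP : (rho H < +oo)%E <-> exists N : nat, forall z z',
  Zpi z = Zpi z' -> (len z' <= N * len z)%N.
Proof.
split=> [/enat_bound[N rN]|[N rN]].
  exists N => z z' zz'; have [a za] := class_surj (Zpi z).
  have [ua|na] := pselect (units H a).
    by rewrite Zpi_unit// -zz' -za; apply/units_class.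
  have z_gt0 : (0 < len z)%N.
    rewrite lt0n; apply/negP => /eqP/size0nil z0; case: na; apply/units_class1.
    by rewrite za /Zpi z0 big_nil.
  have : ((((len z')%:R / (len z)%:R)%R)%:E <= enat N)%E.
    apply: le_trans rN; apply: ereal_sup_ubound.
    exists a, (len z'), (len z); split=> //.
    - by exists z' => //; rewrite /Zfact /= -zz'.
    - by exists z.
  by rewrite lee_fin ler_pdivrMr ?ltr0n// -natrM ler_nat.
apply: (@le_lt_trans _ _ (enat N)); last exact: ltry.
apply: ge_ereal_sup => _ [a [m [n [na [z' z'a <-] [z za <-] ->]]]].
have z_gt0 : (0 < len z)%N.
  rewrite lt0n; apply/negP => /eqP/size0nil z0; case: na; apply/units_class1.
  by rewrite -za /Zpi z0 big_nil.
by rewrite lee_fin ler_pdivrMr ?ltr0n// -natrM ler_nat; apply: rN; rewrite za.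
Qed.

Lemma LambdaP : (Lambda H < +oo)%E <-> exists N : nat, forall a,
  exists2 z, Zpi z = cl a & (len z <= N)%N.
Proof.
split=> [/sup_enatP[N mN]|[N mN]].
  exists N => a; have /inf_enat_le[_ [z za <-] zN] := mN a I.
  by exists z.
apply/sup_enatP; exists N => a _; apply/inf_enat_le; have [z za zN] := mN a.
by exists (len z) => //; exists z.
Qed.

End Finiteness.

(** * Common multiples of the atoms, tameness and elasticity *)

Section Implications.
Variable H : cmonoidType.
Hypothesis spH : strongly_primary H.
Implicit Types (a b c : H) (z : Zmon H).
Local Open Scope classical_set_scope.
Local Open Scope group_scope.
Local Notation cl := (\pi_(Hred H)%qT).
Local Notation len z := (size (enum_mset z)).

Lemma common_multipleP : \bigcap_(u in atoms H) prideal u !=set0 <->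
  exists c, forall v : set_type (atoms (Hred H)), dvdm (val v) (cl c).
Proof.
split=> -[c uc]; exists c.
  move=> v; have [u uv] := class_surj (val v).
  have /uc[w _ <-] : atoms H u by apply/atoms_class; rewrite uv; apply: set_valP.
  by rewrite -uv; apply/dvdm_class/dvdm_mulr.
move=> u /atoms_class/mem_set uA; have /dvdm_class[w ->] := uc (SigSub uA).
by exists w.
Qed.

(** If [u] divides [v ^+ n] for the atom [v], tameness turns the factorization
    [v ^+ n] into one containing [u] by exchanging at most [N] copies of [v].
    Cancelling the unchanged copies, [u] divides a product of at most [N] copies
    of [v]. *)
Lemma tame_common_multiple :
  globally_tame H -> \bigcap_(u in atoms H) prideal u !=set0.
Proof.
move=> /globally_tameP[N tN]; apply/common_multipleP.
have [v _] := atom_exists spH; have [b bv] := class_surj (val v).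
have nb : nonunits H b.
  by suff [] : atoms H b by []; apply/atoms_class; rewrite bv; apply: set_valP.
exists (b ^+ N.+1) => u; rewrite classX bv.
have [g gu] := class_surj (val u).
have ng : nonunits H g.
  by suff [] : atoms H g by []; apply/atoms_class; rewrite gu; apply: set_valP.
have [n _ /dvdm_class] := primary_of_strongly_primary spH ng nb.
rewrite gu classX bv => -[x bnE].
pose z : Zmon H := msetn n v; have [y yx] := factorization_exists spH x.
have zv w : w \in z -> w = v by move=> /msetnP[].
have zE : Zpi z = val v ^+ n by rewrite (Zpi_constant zv) enum_msetn size_nseq.
have [||z' [z'b [t _ z'E]]] := tN u (b ^+ n) z.
- exists ([mset u] `+` y)%mset; split; last by exists y.
  by rewrite /Zfact /= ZpiD Zpi1 yx -bnE classX bv.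
- by rewrite /Zfact /= zE classX bv.
rewrite geq_max => /andP[zN _].
(* The case [u = v] is what requires the exponent [N.+1] to be positive. *)
have [->|uv] := eqVneq u v; first by rewrite expgS; apply: dvdm_mulr.
move: zN; set g' := (z `&` z')%mset => zN.
have zg : z = (g' `+` (z `\` g'))%mset by rewrite msetBDKC// msubsetIl.
have z'g : z' = (g' `+` (z' `\` g'))%mset by rewrite msetBDKC// msubsetIr.
have eqd : Zpi (z `\` g')%mset = Zpi (z' `\` g')%mset.
  apply: (@cmulI _ (Zpi g')); rewrite -!ZpiD -zg -z'g.
  by rewrite z'b zE classX bv.
have /msubset_decomp[w wE] : ([mset u] `<=` z' `\` g')%mset.
  rewrite msub1set in_msetB msetE2 -z'E mset1DE eqxx.
  by rewrite /z msetnE (negPf uv) min0n.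
apply: (@dvdm_trans _ (Zpi (z `\` g')%mset)).
  by rewrite eqd wE ZpiD Zpi1; apply: dvdm_mulr.
rewrite (@Zpi_constant _ _ v).
  by apply: dvdm_exp2l; apply: leq_trans zN _.
by move=> w' /(msubset_subset (msubsetDl _ _))/zv.
Qed.

Section CommonMultiple.
Variable c : H.
Hypothesis uc : forall v : set_type (atoms (Hred H)), dvdm (val v) (cl c).

Lemma common_multiple_nonunit : nonunits H c.
Proof.
have [v _] := atom_exists spH; have [nv _] := set_valP v.
by move=> /units_class uc1; apply: nv; apply: dvdm_unit (uc v) uc1.
Qed.

Lemma Zpi_dvd_expg z : dvdm (Zpi z) (cl c ^+ len z).
Proof.
rewrite /Zpi; elim: (enum_mset z) => [|u s IHs]; first by rewrite big_nil; apply: dvd1m.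
by rewrite big_cons /= expgS; apply: dvdmM (uc u) IHs.
Qed.

(** If [z] has length at most [k] its value divides [c ^+ k], and then the value
    of [z'] cannot be divisible by [c ^+ k * c]. *)
Lemma len_bounded_common_multiple k : exists B : nat, forall z z',
  Zpi z = Zpi z' -> (len z <= k)%N -> (len z' <= B)%N.
Proof.
have nck : nonunits H (c ^+ k * c).
  exact: nonunits_dvd (dvdm_mull _ _) common_multiple_nonunit.
have [B cB] := long_factorizations_dvd spH nck; exists B => z z' zz' zk.
rewrite leqNgt; apply/negP => /ltnW/cB; rewrite -zz' => abs.
apply: (nonunits_ndvd common_multiple_nonunit (a := c ^+ k)); apply/dvdm_class.
rewrite classX; apply: dvdm_trans (dvdm_exp2l _ zk).
exact: dvdm_trans abs (Zpi_dvd_expg z).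
Qed.

(** Any [n0] atoms have a product divisible by [c], hence by [u].  So it is enough
    to refactor a subproduct of [n0] atoms, whose factorizations have bounded
    length; a factorization shorter than that is replaced as a whole. *)
Lemma common_multiple_tame : globally_tame H.
Proof.
have [n0 cn0] := long_factorizations_dvd spH common_multiple_nonunit.
have [B Bn0] := len_bounded_common_multiple n0.
apply/globally_tameP; exists (maxn n0 B) => u a z [z1 [z1a uz1]] za.
have [zn0|/ltnW n0z] := leqP (len z) n0.
  exists z1; split=> //; have := Zdist_leq mset0 z z1; rewrite !msetD0.
  move/leq_trans; apply; rewrite geq_max !leq_max zn0 /=.
  by rewrite (Bn0 z z1) ?orbT// za z1a.
have [x [y [zE xn0]]] := Zmon_split n0z.
have [w xE] : dvdm (val u) (Zpi x).
  by apply: dvdm_trans (uc u) _; apply: cn0; rewrite xn0.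
have [t tw] := factorization_exists spH w.
have utx : Zpi ([mset u] `+` t)%mset = Zpi x by rewrite ZpiD Zpi1 tw xE.
exists (([mset u] `+` t) `+` y)%mset; split.
- by rewrite /Zfact /= ZpiD utx -ZpiD -zE.
- by exists (t `+` y)%mset => //; rewrite msetDA.
- rewrite zE; apply: leq_trans (Zdist_leq _ _ _) _.
  by rewrite geq_max !leq_max xn0 leqnn (Bn0 x) ?orbT// xn0.
Qed.

(** Cutting [z'] into blocks of length [n0], each divisible by [c], gives
    [c ^+ (len z' %/ n0)] as a divisor of the common value, which itself divides
    [c ^+ len z]. *)
Lemma common_multiple_rho : (rho H < +oo)%E.
Proof.
have [n0 cn0] := long_factorizations_dvd spH common_multiple_nonunit.
have cq q z : (q * n0 <= len z)%N -> dvdm (cl c ^+ q) (Zpi z).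
  elim: q z => [|q IHq] z qz; first exact: dvd1m.
  have [|x [y [zE xn0]]] := @Zmon_split _ z n0; first by lia.
  rewrite zE ZpiD expgS; apply: dvdmM; first by apply: cn0; rewrite xn0.
  by apply: IHq; move: qz; rewrite zE len_msetD xn0; lia.
apply/rhoP; exists (2 * n0)%N => z z' zz'.
have [z0|z_gt0] := posnP (len z).
  rewrite Zpi_unit// -zz' /Zpi (size0nil z0) big_nil.
  by exists 1; rewrite mulg1.
rewrite leqNgt; apply/negP => zz'N.
have := cq (len z).+1 z'; rewrite -zz' => /(_ _)/dvdm_trans abs.
apply: (nonunits_ndvd common_multiple_nonunit (a := c ^+ len z)); apply/dvdm_class.
rewrite -expgSr !classX; apply: abs (Zpi_dvd_expg z); nia.
Qed.

End CommonMultiple.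

Lemma rho_rho_k : (rho H < +oo)%E -> forall k : nat, (rho_ H k < +oo)%E.
Proof.
move=> /rhoP[N rN] k; apply/rho_kP; exists (N * k)%N => z z' zz' zk.
by rewrite -zk; apply: rN.
Qed.

(** With bounded minimal lengths and finite [rho_ k] all lengths would be bounded,
    but the powers of an atom have arbitrarily long factorizations. *)
Lemma rho_k_Lambda :
  (forall k : nat, (0 < k)%N -> (rho_ H k < +oo)%E) -> (Lambda H = +oo)%E.
Proof.
move=> rk; apply: contrapT => /eqP; rewrite -ltey => /LambdaP[N minN].
have [B BN] : exists B : nat, forall k z z', (0 < k <= N)%N ->
    Zpi z = Zpi z' -> len z = k -> (len z' <= B)%N.
  elim: N {minN} => [|N [B BN]]; first by exists 0%N => -[].
  have /rho_kP[B' B'N] := rk N.+1 isT.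
  exists (maxn B B') => k z z' /andP[k0].
  rewrite leq_eqVlt => /predU1P[->|kN] zz' zk.
    by rewrite leq_max (B'N z)// orbT.
  by rewrite leq_max (BN k z)// k0.
have [v _] := atom_exists spH; have [b bv] := class_surj (val v).
have [z zb zN] := minN (b ^+ B.+1).
have zz' : Zpi z = Zpi (msetn B.+1 v : Zmon H).
  rewrite zb (@Zpi_constant _ _ v) => [|w /msetnP[]//].
  by rewrite enum_msetn size_nseq classX bv.
have z_gt0 : (0 < len z)%N.
  rewrite lt0n; apply/negP => /eqP/size0nil z0.
  have [+ _] := set_valP v; apply; exists (val v ^+ B).
  by rewrite -expgS -bv -classX -zb /Zpi z0 big_nil.
have := BN (len z) z _ _ zz' erefl; rewrite z_gt0 zN => /(_ isT).
by rewrite enum_msetn size_nseq ltnn.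
Qed.

End Implications.

(** * Unbounded minimal lengths and unsplittable powers *)

Section UnsplittablePowers.
Variable H : cmonoidType.
Hypothesis spH : strongly_primary H.
Implicit Types (a b c d : H) (z : Zmon H).
Local Open Scope group_scope.
Local Notation cl := (\pi_(Hred H)%qT).
Local Notation len z := (size (enum_mset z)).

(** Otherwise [b ^+ k * c], with [c] not divisible by [b], would be a product of
    three elements of bounded length, apart from small powers of [b]. *)
Lemma unsplittable_power b d n0 : (Lambda H = +oo)%E ->
  nonunits H b -> nonunits H d ->
  exists2 n : nat, (n0 <= n)%N &
    forall x y, b ^+ n = x * y -> dvdm d x \/ dvdm d y.
Proof.
move=> LH nb nd; apply: contrapT => nex.
have split n : (n0 <= n)%N ->
    exists x y, [/\ b ^+ n = x * y, ~ dvdm d x & ~ dvdm d y].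
  move=> nn0; apply: contrapT => nsplit; apply: nex; exists n => // x y bxy.
  apply: contrapT => /not_orP[ndx ndy]; apply: nsplit.
  by exists x, y.
have [Bb bP] := undivided_len_bounded spH nb.
have [Bd dP] := undivided_len_bounded spH nd.
have [zb zbE] := factorization_exists spH (cl b).
have powers k : exists2 z, Zpi z = cl (b ^+ k) & (len z <= k * len zb)%N.
  elim: k => [|k [z zE zk]]; first by exists mset0; rewrite ?Zpi0 // enum_mset0.
  exists (zb `+` z)%mset; first by rewrite ZpiD zE zbE -classM expgS.
  by rewrite len_msetD mulSn leq_add2l.
suff : (Lambda H < +oo)%E by rewrite LH.
apply/LambdaP; exists (n0 * len zb + Bd + Bd + Bb)%N => a.
have [k [c [-> nbc]]] := max_power spH a nb.
have [zc zcE] := factorization_exists spH (cl c).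
have zcB := bP _ _ nbc zcE.
have [kn0|n0k] := ltnP k n0.
  have [z zE zk] := powers k.
  exists (z `+` zc)%mset; first by rewrite ZpiD zE zcE classM.
  rewrite len_msetD.
  have : (k * len zb <= n0 * len zb)%N by rewrite leq_mul2r ltnW ?orbT.
  lia.
have [x [y [bxy ndx ndy]]] := split _ n0k.
have [zx zxE] := factorization_exists spH (cl x).
have [zy zyE] := factorization_exists spH (cl y).
have := (dP _ _ ndx zxE, dP _ _ ndy zyE) => -[zxB zyB].
exists ((zx `+` zy) `+` zc)%mset; first by rewrite !ZpiD zxE zyE zcE -!classM bxy.
by rewrite !len_msetD; lia.
Qed.

End UnsplittablePowers.

(** * The complete integral closure *)

Section Quotient.
Variable H : cmonoidType.
Implicit Types (a b c d : H) (x y w : qgroup H).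
Local Open Scope classical_set_scope.
Local Open Scope group_scope.

Lemma toq_inj : injective (@toq H).
Proof. by move=> a b /qrelP/eqP /=; rewrite !mulg1. Qed.

Lemma toqX a n : toq (a ^+ n) = toq a ^+ n.
Proof. by elim: n => [|n IHn]; rewrite // !expgS toqM IHn. Qed.

Lemma inq_toq a : inq H (toq a). Proof. by exists a. Qed.

Lemma inqM x y : inq H x -> inq H y -> inq H (x * y).
Proof. by move=> [a _ <-] [b _ <-]; rewrite -toqM; apply: inq_toq. Qed.

Lemma inqX x n : inq H x -> inq H (x ^+ n).
Proof. by move=> [a _ <-]; rewrite -toqX; apply: inq_toq. Qed.

Lemma qgroup_frac x : exists a b, x * toq b = toq a.
Proof.
elim/quotW: x => -[a b]; exists a, b; rewrite /toq [LHS]piE /=.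
by apply/qrelP; rewrite /= !mulg1.
Qed.

Lemma inq_cic x : inq H x -> cic H x.
Proof. by move=> xH; exists 1 => n _; rewrite toq1 mul1g; apply: inqX. Qed.

(** Division of the exponent by [i] leaves finitely many remainders, and a power
    of the denominator of [x] clears the corresponding powers of [x]. *)
Lemma root_cic x i : (0 < i)%N -> inq H (x ^+ i) -> cic H x.
Proof.
move=> i0 xi; have [a [b xb]] := qgroup_frac x.
exists (b ^+ i) => n _; rewrite {1}(divn_eq n i) expgnDr mulnC expgnA.
rewrite cmulCA; apply: inqM; first exact: inqX.
have : (n %% i <= i)%N by rewrite ltnW// ltn_mod.
move: (n %% i)%N => r ri; rewrite -(subnK ri) toqX expgnDr -cmulA -cexpM.
rewrite (cmulC (toq b)) xb -!toqX.
by apply: inqM; apply: inq_toq.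
Qed.

End Quotient.

Section ClosureValuation.
Variable H : cmonoidType.
Hypothesis spH : strongly_primary H.
Implicit Types (a b c d : H) (x y w : qgroup H).
Local Open Scope classical_set_scope.
Local Open Scope group_scope.

Lemma large_power_inq b x : nonunits H b -> exists p : nat, inq H (x * toq b ^+ p).
Proof.
move=> nb; have [a [d xd]] := qgroup_frac x.
have [p _ [e bde]] := primary_of_strongly_primary spH
  (nonunits_dvd (dvdm_mull b d) nb) nb.
exists p; rewrite -toqX bde !toqM !cmulA xd -!toqM; exact: inq_toq.
Qed.

(** Going from [i] to [i.+1] costs [b ^+ p] on each side, so the two products
    multiply to [b ^+ (N + p.*2)].  By unsplittability one side gives back
    [b ^+ p.*2], which restores the total exponent [N].  If that side has too few
    factors [b] to give back, a power of [x] or of [x^-1] is already in [H]. *)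
Lemma powers_balanced x b p N :
  inq H (x * toq b ^+ p) -> inq H (x^-1 * toq b ^+ p) ->
  (forall c d, b ^+ (N + p.*2) = c * d ->
     dvdm (b ^+ p.*2) c \/ dvdm (b ^+ p.*2) d) ->
  [\/ cic H x, cic H x^-1 |
    forall i, exists2 j, (j <= N)%N &
      inq H (x ^+ i * toq b ^+ j) /\ inq H (x^-1 ^+ i * toq b ^+ (N - j))].
Proof.
move=> xp Vxp nsplit.
have [cx|ncx] := pselect (cic H x); first by apply: Or31.
have [cVx|ncVx] := pselect (cic H x^-1); first by apply: Or32.
apply: Or33; elim=> [|i [j jN [xj Vxj]]].
  by exists 0%N => //; split; rewrite expg0 mul1g -toqX; apply: inq_toq.
have [c _ cE] : inq H (x ^+ i.+1 * toq b ^+ (j + p)).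
  by rewrite expgSr expgnDr cmulACA; apply: inqM.
have [d _ dE] : inq H (x^-1 ^+ i.+1 * toq b ^+ (N - j + p)).
  by rewrite expgSr expgnDr cmulACA; apply: inqM.
(* The side divisible by [b ^+ p.*2] gives up that factor: its exponent [k + p]
   drops to [k - p], or, if [k < p], no factor [b] remains. *)
have step w e k : toq e = w * toq b ^+ (k + p) -> dvdm (b ^+ p.*2) e ->
    if (p <= k)%N then inq H (w * toq b ^+ (k - p)) else inq H w.
  move=> eE [t et]; case: leqP => pk.
    exists t => //; apply: (@cmulI _ (toq b ^+ p.*2)).
    rewrite -toqX -toqM -et eE toqX cmulCA -expgnDr.
    by congr (_ * _ ^+ _); lia.
  exists (b ^+ (p - k) * t) => //; apply: (@cmulI _ (toq b ^+ (k + p))).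
  rewrite [RHS]cmulC -eE et !toqM !toqX cmulA -expgnDr.
  by congr (_ ^+ _ * _); lia.
have /nsplit : b ^+ (N + p.*2) = c * d.
  apply: toq_inj; rewrite toqM cE dE cmulACA -cexpM mulgV expg1n mul1g.
  by rewrite -expgnDr toqX; congr (_ ^+ _); lia.
case=> [/(step _ _ _ cE)|/(step _ _ _ dE)]; case: leqP => // pj.
- move=> xj'; exists (j - p)%N; first by lia.
  split=> //; rewrite (_ : N - (j - p) = N - j + p)%N; last by lia.
  by rewrite -dE; apply: inq_toq.
- by move=> /root_cic => /(_ isT).
- move=> xj'; exists (j + p)%N; first by lia.
  split; first by rewrite -cE; apply: inq_toq.
  by rewrite subnDA.
- by move=> /root_cic => /(_ isT).
Qed.

(** Once the exponents stay balanced forever, [b ^+ N] is a common denominator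
    for the powers of [x^-1]. *)
Lemma Lambda_cic : (Lambda H = +oo)%E -> forall x, cic H x \/ cic H x^-1.
Proof.
move=> LH x; have [b nb] := exists_nonunit spH.
have [p1 xp1] := large_power_inq x nb; have [p2 xp2] := large_power_inq x^-1 nb.
pose p := (p1 + p2).+1.
have xp : inq H (x * toq b ^+ p).
  rewrite /p -addnS expgnDr cmulA -toqX -(toqX b p2.+1); apply: inqM (inq_toq _).
  by rewrite toqX.
have Vxp : inq H (x^-1 * toq b ^+ p).
  rewrite /p -addSn addnC expgnDr cmulA -toqX -(toqX b p1.+1); apply: inqM (inq_toq _).
  by rewrite toqX.
have nbp : nonunits H (b ^+ p.*2).
  by rewrite doubleS expgS; apply: nonunits_dvd nb; apply: dvdm_mulr.
have [n np nsplit] := unsplittable_power spH p.*2 LH nb nbp.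
rewrite -(subnK np) in nsplit.
have [|| bal] := powers_balanced xp Vxp nsplit; [by left|by right|].
right; exists (b ^+ (n - p.*2)) => i i0; have [j jN [xj Vxj]] := bal i.
rewrite toqX cmulC -(subnK jN) expgnDr cmulA.
by apply: inqM; rewrite // -toqX; apply: inq_toq.
Qed.

(** A common denominator of the negative powers of [b] would be divisible by all
    powers of [b]. *)
Lemma cic_nonunit_inv b : nonunits H b -> ~ cic H (toq b)^-1.
Proof.
move=> nb [c cb]; have [n []] := nonunit_power_bounded spH c nb.
case: n => [|n]; first exact: dvd1m.
have [a _ aE] := cb n.+1 isT; exists a; apply: toq_inj.
by rewrite toqM aE toqX cmulCA -cexpM mulgV expg1n mulg1.
Qed.

Lemma units_cicm (x : cicm H) : units (cicm H) x <-> cic H (val x)^-1.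
Proof.
split=> [[y /(congr1 val)]|Vx].
  by rewrite valM => /mulg1_eq ->; apply/set_mem/(valP y).
exists (Sub (val x)^-1 (mem_set Vx)); apply: val_inj.
by rewrite valM SubK mulgV.
Qed.

Lemma dvdm_cicm (x y : cicm H) : dvdm x y <-> cic H (val y * (val x)^-1).
Proof.
split=> [[t ->]|yx].
  by rewrite valM cmulC mulKg; apply/set_mem/(valP t).
exists (Sub (val y * (val x)^-1) (mem_set yx)); apply: val_inj.
by rewrite valM SubK cmulCA mulgV mulg1.
Qed.

Lemma valuation_cicm : (forall x, cic H x \/ cic H x^-1) -> valuation (cicm H).
Proof.
move=> Hx x y; case: (Hx (val y * (val x)^-1)); first by left; apply/dvdm_cicm.
by rewrite invgF; right; apply/dvdm_cicm.
Qed.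

Section Conductor.
Local Notation f := (colon (inq H) (cic H)).

Lemma colon_inq x : f x -> inq H x.
Proof. by rewrite -[X in inq H X]mulg1; apply; apply/inq_cic/inq_toq. Qed.

(** A nonempty conductor makes the complete integral closure completely
    integrally closed, because an element of the conductor returns all the
    products [x * y ^+ n] to [H] at once. *)
Lemma cic_of_power_multiples x y : f !=set0 ->
  (forall n : nat, (0 < n)%N -> cic H (x * y ^+ n)) -> cic H y.
Proof.
move=> [z fz] xy; have [a [b xb]] := qgroup_frac x.
have [c _ cE] := colon_inq fz; exists (c * a) => n n0.
rewrite toqM cE -xb (cmulC x) (cmulCA z) -!cmulA.
by apply: inqM (inq_toq _) _; apply/fz/xy.
Qed.

(** In a valuation monoid, if [x] divides no power of [y] then all powers of [y]
    divide [x], so that [y^-1] is almost integral and [y] is a unit. *)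
Lemma primary_cicm : f !=set0 -> valuation (cicm H) -> primary (cicm H).
Proof.
move=> fn0 V; split.
  have [b nb] := exists_nonunit spH => /seteqP[_ allu].
  apply: (cic_nonunit_inv nb).
  by have /(_ I)/units_cicm := allu (Sub (toq b) (mem_set (inq_cic (inq_toq b)))).
move=> x y nx ny; apply: contrapT => nxy; apply/ny/units_cicm.
apply: (cic_of_power_multiples (x := val x) fn0) => n n0.
case: (V x (y ^+ n)) => [[t xyn]|/dvdm_cicm].
  by case: nxy; exists n; split=> //; exists t.
rewrite expVgn; suff -> : val (y ^+ n) = val y ^+ n by [].
by elim: n {n0} => // n IHn; rewrite !expgS valM IHn.
Qed.

Local Notation m := [set toq a | a in nonunits H].

(** If [u] does not divide [a * x], then [u = a * (x * t)] with [x * t] in [H];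
    as [u] is an atom and [a] a nonunit, [x * t] is a unit of [H], so [u] and [a]
    are associated. *)
Lemma valuation_conductor : valuation (cicm H) ->
  setmul f m `<=` \bigcap_(u in atoms H) dil (toq u) (cic H).
Proof.
move=> V _ [x fx [_ [a na <-] <-]] u [nu iu]; have [c _ cE] := colon_inq fx.
pose U : cicm H := Sub (toq u) (mem_set (inq_cic (inq_toq u))).
pose X : cicm H := Sub (toq (a * c)) (mem_set (inq_cic (inq_toq (a * c)))).
have [[t /(congr1 val)]|[t /(congr1 val)]] := V U X; rewrite valM !SubK => e.
  by exists (val t); [apply/set_mem/(valP t)|rewrite -e toqM cE cmulC].
have [d _ dE] : inq H (x * val t) by apply/fx/set_mem/(valP t).
have ud : u = a * d by apply: toq_inj; rewrite e !toqM dE -cE cmulA.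
have [//|[d' dd']] := iu a d ud.
exists (x * toq d'); first by apply/inq_cic/inqM; [apply: colon_inq|apply: inq_toq].
by rewrite cmulCA -toqM ud -cmulA dd' mulg1.
Qed.

Lemma valuation_conductor2 :
  setmul f m `<=` \bigcap_(u in atoms H) dil (toq u) (cic H) ->
  setmul (setmul f f) m `<=` \bigcap_(u in atoms H) dil (toq u) (inq H).
Proof.
move=> fm _ [_ [x fx [y fy <-]] [t mt <-]] u au.
have [|z cz e] := fm (y * t) _ u au; first by exists y => //; exists t.
by exists (x * z); [apply: fx|rewrite cmulCA e cmulA].
Qed.

Lemma conductor_common_multiple : f !=set0 ->
  setmul (setmul f f) m `<=` \bigcap_(u in atoms H) dil (toq u) (inq H) ->
  \bigcap_(u in atoms H) prideal u !=set0.
Proof.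
move=> [x fx] ffm; have [a na] := exists_nonunit spH.
have [c _ cE] := colon_inq fx.
exists (c * c * a) => u au.
have [|_ [d _ <-] e] := ffm (x * x * toq a) _ u au.
  by exists (x * x); [exists x => //; exists x|exists (toq a) => //; exists a].
by exists d => //; apply: toq_inj; rewrite !toqM cE e.
Qed.

End Conductor.

End ClosureValuation.

(** * The conductor of a strongly primary domain *)

Section RootDescent.
Variable H : cmonoidType.
Hypothesis spH : strongly_primary H.
Implicit Types (a b c d : H) (x y w : qgroup H).
Local Open Scope classical_set_scope.
Local Open Scope group_scope.

(** If [x * x] is divisible by [b], then [b ^+ M] is a denominator of [x]: the
    hypothesis cancels surplus factors [b] one by one.  Hence the exponent of the denominator of a
    square root is about half the exponent for the square, plus a constant.
    Starting from the bounded denominators of [x ^+ (2 ^ m)] with [m] large,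
    repeated square roots bring the exponent down to [2 * M + 2], the fixed point
    of this recursion, whatever [x] in the closure is. *)
Lemma square_root_conductor b M : nonunits H b ->
  (forall r t, r * r = b ^+ M.*2 * (b * t) -> dvdm b r) ->
  colon (inq H) (cic H) !=set0.
Proof.
move=> nb sqr; pose B := toq b.
have sqrt x : inq H (B^-1 * (x * x)) -> inq H (B ^+ M * x).
  move=> [t _ tE]; have [p xp] := large_power_inq spH x nb.
  have {xp} : inq H (B ^+ (M + p) * x).
    rewrite expgnDr -cmulA (cmulC _ x); apply: inqM xp.
    by rewrite -toqX; apply: inq_toq.
  (* Cancel the surplus powers of [b] one at a time. *)
  elim: p => [|p IHp]; first by rewrite addn0.
  move=> [r _ rE]; apply: IHp.
  have /sqr[r' rr'] : r * r = b ^+ M.*2 * (b * (b ^+ p.+1.*2 * t)).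
    move: (p.+1) rE => q rE; apply: toq_inj; rewrite !toqM !toqX tE rE.
    rewrite cmulACA -expgnDr addnn doubleD (cmulCA _ B^-1) (cmulA B) mulgV mul1g.
    by rewrite expgnDr -cmulA.
  exists r' => //; apply: (@cmulI _ B).
  by rewrite -toqM -rr' rE addnS expgS cmulA.
have iter_sqrt m x r : (r < 2 ^ m)%N ->
    inq H (B ^+ (M.*2.+2 + r) * x ^+ (2 ^ m)) -> inq H (B ^+ M.*2.+2 * x).
  elim: m r => [|m IHm] r.
    by rewrite expn0 ltnS leqn0 => /eqP->; rewrite addn0 expg1.
  move=> rm xr; apply: (IHm r./2); first by rewrite expnS in rm; lia.
  have -> : (M.*2.+2 + r./2 = M + (M + r./2).+2)%N by lia.
  rewrite expgnDr -cmulA; apply: sqrt.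
  (* [h] is the least exponent with [2 * M + 2 + r < h + h], so that a factor [b]
     is left over after the denominator of the square has been cleared. *)
  set h := (M + r./2).+2.
  rewrite cmulACA -!expgnDr; rewrite expnS mul2n -(addnn (2 ^ m)) in xr.
  have : (M.*2.+2 + r < h + h)%N by lia.
  move: (M.*2.+2 + r)%N xr => e xr /subnK <-; rewrite addnS -addSn.
  rewrite expgnDr expgS -!cmulA mulKg.
  by apply: inqM xr; rewrite -toqX; apply: inq_toq.
exists (B ^+ M.*2.+2) => x [c cx].
(* The exponent [r] depends on [x]; [r] square roots suffice as [r < 2 ^ r]. *)
have [r _ [c' bc]] := primary_of_strongly_primary spH
  (nonunits_dvd (dvdm_mull b c) nb) nb.
apply: (iter_sqrt r x r); first exact: ltn_expl.
rewrite expgnDr -cmulA; apply: inqM; first by rewrite -toqX; apply: inq_toq.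
rewrite -toqX bc !toqM (cmulC (toq c)) -!cmulA; apply: inqM (inq_toq _) _.
by rewrite cmulCA; apply: inqM (inq_toq _) _; apply: cx; rewrite expn_gt0.
Qed.

End RootDescent.

Section DomainArithmetic.
Variable R : idomainType.
Hypothesis spR : strongly_primary_domain R.
Implicit Types (r s t : R) (b : nz R).
Local Open Scope classical_set_scope.
Local Open Scope ring_scope.

(** The cast pins the subtype predicate, which [exist] alone does not infer. *)
Definition mk_nz r (r0 : r != 0) : nz R := exist _ r r0.

Lemma unit_nz b r : val b * r = 1 -> units (nz R) b.
Proof.
move=> br; have r0 : r != 0.
  by apply: contra_eq_neq br => ->; rewrite mulr0 eq_sym oner_neq0.
by exists (mk_nz r0); apply: val_inj.
Qed.

(** Modulo [t = 1 + b r] the element [- b r] is [1], and so are its powers;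
    but if [t] were a nonunit it would divide a power of [b]. *)
Lemma one_add_nonunit b r : nonunits (nz R) b -> exists s, (1 + val b * r) * s = 1.
Proof.
move=> nb; have [t0|t0] := eqVneq (1 + val b * r) 0.
  case: nb; apply: (@unit_nz _ (- r)); rewrite mulrN.
  by apply/eqP; rewrite eq_sym -subr_eq0 opprK t0.
pose t : nz R := mk_nz t0.
have [[s ts]|nt] := pselect (units (nz R) t).
  by exists (val s); rewrite -[LHS]/(val (t * s)%g) ts.
have [n _ [s bs]] := primary_of_strongly_primary spR nt nb.
have valX k : val (b ^+ k)%g = val b ^+ k.
  by elim: k => // k IHk; rewrite expgS exprS -IHk.
have {bs} := congr1 val bs; rewrite valX /= => bs.
pose x := - (val b * r).
have xE : x ^+ n = (1 + val b * r) * (val s * (- r) ^+ n).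
  by rewrite /x -mulrN exprMn bs mulrA.
have xn := subrX1 x n; exists (val s * (- r) ^+ n + \sum_(i < n) x ^+ i).
rewrite mulrDr -xE; have -> : 1 + val b * r = - (x - 1) by rewrite /x opprB opprK.
by rewrite mulNr -xn opprB addrCA subrr addr0.
Qed.

(** The elements without an inverse form an ideal: if [a u + v] is invertible,
    dividing by it exhibits one of [u], [v] as a unit by [one_add_nonunit].  A
    larger ideal would contain a unit, so this one is maximal, and [M] is the
    only maximal ideal. *)
Lemma local_nonunits (M : set R) : local_with M ->
  M = [set r | ~ exists s, r * s = 1].
Proof.
move=> [_ Muniq]; apply/esym/Muniq; set N := [set r | _].
have addN r s t : (1 = r * s + t * s)  -> N r -> N t -> False.
  move=> e Nr Nt; have [r0|r0] := eqVneq r 0.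
    by apply: Nt; exists s; rewrite e r0 mul0r add0r.
  have nb : nonunits (nz R) (mk_nz r0).
    by move=> [s' /(congr1 val) rs]; apply: Nr; exists (val s').
  have [u] := one_add_nonunit (- s) nb; rewrite /= (_ : 1 + r * - s = t * s).
    by move=> tsu; apply: Nt; exists (s * u); rewrite mulrA.
  by rewrite mulrN e addrAC subrr add0r.
split.
  split.
  - by rewrite unfold_in inE => -[s] /esym/eqP; rewrite mul0r oner_eq0.
  - by rewrite unfold_in; apply/negP; rewrite inE; apply; exists 1; rewrite mulr1.
  - move=> a u v; rewrite !unfold_in !inE => Nu Nv [s aus].
    apply: (addN (a * u) s v) Nv; first by rewrite -mulrDl.
    by move=> [t aut]; apply: Nu; exists (a * t); rewrite -aut mulrCA mulrA.
move=> J [_ J1 JD] NJ; apply/seteqP; split=> // r Jr [s rs].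
move/negP: J1; apply; have := JD s r 0; rewrite addr0 mulrC rs; apply.
  by rewrite unfold_in; apply/mem_set.
rewrite unfold_in; apply/mem_set/NJ => -[t] /esym/eqP.
by rewrite mul0r oner_eq0.
Qed.

(** With [c = b ^+ M], the product of [c + r] and [c - r] is
    [c ^+ 2 * (1 - b t)], which is [b ^+ (2 * M)] up to a unit.  Unsplittability
    makes one of [c + r], [c - r] divisible by [b], hence also [r]. *)
Lemma unsplittable_square (b : nz R) M : nonunits (nz R) b -> (0 < M)%N ->
  (forall x y : nz R, (b ^+ M.*2 = x * y)%g -> dvdm b x \/ dvdm b y) ->
  forall r t : nz R, (r * r = b ^+ M.*2 * (b * t))%g -> dvdm b r.
Proof.
move=> nb M0 nsplit r t /(congr1 val); rewrite !val_nzM.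
set c := val (b ^+ M)%g; have cE : val (b ^+ M.*2)%g = c * c.
  by rewrite -val_nzM -expgnDr addnn.
have [c' cb] : exists c', c = val b * c'.
  by exists (val (b ^+ M.-1)%g); rewrite -val_nzM -expgS prednK.
rewrite cE => rrE.
have [e ue] := one_add_nonunit (- val t) nb.
have e0 : e != 0.
  by apply: contra_eq_neq ue => ->; rewrite mulr0 eq_sym oner_neq0.
(* The factor [e] absorbs the unit [1 - b t] so that the product is exactly
   the unsplittable power. *)
have yze : (c + val r) * ((c - val r) * e) = c * c.
  rewrite mulrA -[RHS]mulr1 -ue mulrA; congr (_ * _).
  transitivity (c * c - val r * val r); first by ring.
  by rewrite rrE; ring.
have : (c + val r) * ((c - val r) * e) != 0 by rewrite yze -cE (valP (b ^+ M.*2)%g).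
rewrite !mulf_eq0 !negb_or => /and3P[y0 z0 _].
pose y : nz R := mk_nz y0; pose z : nz R := mk_nz z0.
pose e' : nz R := mk_nz e0.
have [|[w yw]|[w zw]] := nsplit y (z * e')%g.
- by apply: val_inj; rewrite cE -yze.
- have rE : val r = val b * (val w - c').
    by rewrite mulrBr -cb -val_nzM -yw /= addrAC subrr add0r.
  have w0 : val w - c' != 0.
    by have := valP r; rewrite rE mulf_eq0 negb_or => /andP[].
  by exists (mk_nz w0); apply: val_inj.
- have rE : val r = val b * (c' - val w * (1 + val b * - val t)).
    rewrite mulrBr -cb mulrA -val_nzM -zw /= -mulrA (mulrC e) ue mulr1.
    by rewrite opprB addrCA subrr addr0.
  have w0 : c' - val w * (1 + val b * - val t) != 0.
    by have := valP r; rewrite rE mulf_eq0 negb_or => /andP[].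
  by exists (mk_nz w0); apply: val_inj.
Qed.

(** Unsplittable powers are taken for [b * b], so that the exponent of [b] is
    even and leaves room for a square root. *)
Lemma Lambda_conductor : (Lambda (nz R) = +oo)%E ->
  colon (inq (nz R)) (cic (nz R)) !=set0.
Proof.
move=> LR; have [b nb] := exists_nonunit spR.
have nbb : nonunits (nz R) (b * b)%g by apply: nonunits_dvd nb; apply: dvdm_mulr.
have [M M0 nsplit] := unsplittable_power spR 1 LR nbb nb.
apply: (square_root_conductor spR nb (M := M)).
apply: unsplittable_square => // x y bxy; apply: nsplit.
by rewrite -bxy -expg2 -expgnA mul2n.
Qed.

End DomainArithmetic.

(** * From the nonzero elements of a domain to its fraction field *)

Section Isomorphism.
Variables (G G' : cmonoidType) (g : G -> G').
Hypothesis gM : {morph g : a b / monoid.mul a b >-> monoid.mul a b}.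
Hypothesis gI : injective g.
Hypothesis gS : forall a', exists a, g a = a'.
Local Open Scope group_scope.

Lemma iso_dvdm a b : dvdm (g a) (g b) <-> dvdm a b.
Proof.
split=> [[c' e]|[c ->]]; last by exists (g c); rewrite gM.
by have [c gc] := gS c'; exists c; apply: gI; rewrite gM gc.
Qed.

Lemma iso1 : g 1 = 1.
Proof. by apply: (@cmulI _ (g 1)); rewrite -gM !mulg1. Qed.

Lemma iso_units a : units G' (g a) <-> units G a.
Proof.
split=> [[c' e]|[c e]]; last by exists (g c); rewrite -gM e iso1.
by have [c gc] := gS c'; exists c; apply: gI; rewrite gM gc iso1.
Qed.

Lemma iso_valuation : valuation G -> valuation G'.
Proof.
move=> V a' b'; have [a <-] := gS a'; have [b <-] := gS b'.
by case: (V a b) => /iso_dvdm; [left|right].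
Qed.

Lemma iso_valuation_inv : valuation G' -> valuation G.
Proof. by move=> V a b; case: (V (g a) (g b)) => /iso_dvdm; [left|right]. Qed.

Lemma iso_primary : primary G -> primary G'.
Proof.
move=> [nG pG]; split=> [allu|a' b'].
  apply: nG; apply/seteqP; split=> // a _; apply/iso_units.
  by rewrite allu.
have [a <-] := gS a'; have [b <-] := gS b' => na nb.
have [||n [n0 [c _ acb]]] := pG a b.
- by move=> /iso_units.
- by move=> /iso_units.
exists n; split=> //; exists (g c) => //.
rewrite -gM acb; elim: n {n0 acb} => [|n IHn]; first exact: iso1.
by rewrite !expgS gM IHn.
Qed.

End Isomorphism.

Section DomainTransport.
Variable R : idomainType.
Local Open Scope classical_set_scope.
Local Open Scope ring_scope.
Local Notation K := {fraction R}.
Local Notation H := (nz R).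
Implicit Types (A B : set (qgroup H)) (x y : K).

Definition lift0 A : set K := [set 0] `|` (@qfrac R) @` A.

Lemma qfrac_neq0 (q : qgroup H) : qfrac q != 0.
Proof.
apply/eqP => q0; have := qfracM q q^-1%g.
by rewrite mulgV qfrac1 q0 mul0r => /eqP; rewrite oner_eq0.
Qed.

Lemma qfrac_surj x : x != 0 -> exists q, qfrac q = x.
Proof.
move=> x0; have [a [b [b0 ab]]] := fracE x.
have a0 : a != 0.
  by apply: contraNneq x0 => a0; rewrite ab a0 tofrac0 mul0r.
exists (\pi_(qgroup H)%qT (mk_nz a0, mk_nz b0)).
by rewrite qfrac_pi /= -ab.
Qed.

Lemma lift0_qfrac A q : lift0 A (qfrac q) <-> A q.
Proof.
split=> [[/eqP|[p Ap /qfrac_inj <-//]]|Aq]; last by right; exists q.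
by rewrite (negPf (qfrac_neq0 q)).
Qed.

(** A set of fractions containing zero is determined by its nonzero elements,
    and these are exactly the images of elements of the quotient group. *)
Lemma lift0_eq (X : set K) A : X 0 -> (forall q, X (qfrac q) <-> A q) -> X = lift0 A.
Proof.
move=> X0 XA; apply/seteqP; split=> x; last first.
  by move=> [->//|[q Aq <-]]; apply/XA.
have [->|x0] := eqVneq x 0; first by left.
by have [q <-] := qfrac_surj x0; move=> /XA Aq; right; exists q.
Qed.

Lemma lift0_sub A B : lift0 A `<=` lift0 B <-> A `<=` B.
Proof.
split=> AB; first by move=> q Aq; apply/lift0_qfrac/AB/lift0_qfrac.
by move=> _ [->|[q /AB Bq <-]]; [left|right; exists q].
Qed.

Lemma lift0_nonzero A : [set 0] <> lift0 A <-> A !=set0.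
Proof.
split=> [A0|[q Aq] e].
  apply: contrapT => An; apply: A0; apply: lift0_eq => // q.
  split=> [/eqP|Aq]; first by rewrite (negPf (qfrac_neq0 q)).
  by case: An; exists q.
have /lift0_qfrac := Aq; rewrite -e => /eqP.
by rewrite (negPf (qfrac_neq0 q)).
Qed.

Lemma setmulK_lift0 A B : setmulK (lift0 A) (lift0 B) = lift0 (setmul A B).
Proof.
apply: lift0_eq => [|q]; first by exists 0; [left|exists 0; [left|rewrite mul0r]].
split=> [[x Ax [y By]]|[a Aa [b Bb <-]]]; last first.
  rewrite qfracM; exists (qfrac a); first exact/lift0_qfrac.
  by exists (qfrac b) => //; apply/lift0_qfrac.
case: Ax => [->|[a Aa <-]].
  by move/esym/eqP; rewrite mul0r (negPf (qfrac_neq0 q)).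
case: By => [->|[b Bb <-]].
  by move/esym/eqP; rewrite mulr0 (negPf (qfrac_neq0 q)).
by rewrite -qfracM => /qfrac_inj <-; exists a => //; exists b.
Qed.

Lemma dilK_lift0 (u : H) A :
  dilK (FracField.tofrac (val u)) (lift0 A) = lift0 (dil (toq u) A).
Proof.
rewrite -qfrac_toq; apply: lift0_eq => [|q]; first by exists 0; [left|rewrite mulr0].
split=> [[x Ax]|[a Aa <-]]; last first.
  by rewrite qfracM; exists (qfrac a) => //; apply/lift0_qfrac.
case: Ax => [->|[a Aa <-]].
  by move/esym/eqP; rewrite mulr0 (negPf (qfrac_neq0 q)).
by rewrite -qfracM => /qfrac_inj <-; exists a.
Qed.

Lemma sub_bigcap_dilK A B :
  lift0 A `<=` \bigcap_(u in atoms H) dilK (FracField.tofrac (val u)) (lift0 B) <->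
  A `<=` \bigcap_(u in atoms H) dil (toq u) B.
Proof.
split=> AB; last first.
  by move=> x Ax u au; rewrite dilK_lift0; move: x Ax; apply/lift0_sub => q /AB; apply.
move=> q /(lift0_qfrac A)/AB Bq u au.
by apply/lift0_qfrac; rewrite -dilK_lift0; apply: Bq.
Qed.

Lemma inK_lift0 (X : set R) : X 0 ->
  inK X = lift0 [set toq a | a in [set a : H | X (val a)]].
Proof.
move=> X0; apply: lift0_eq => [|q]; first by exists 0; rewrite ?tofrac0.
split=> [[r Xr rq]|[a Xa <-]]; last by exists (val a) => //; rewrite qfrac_toq.
have r0 : r != 0 by rewrite -tofrac_eq0 rq qfrac_neq0.
by exists (mk_nz r0) => //; apply: qfrac_inj; rewrite qfrac_toq.
Qed.

Lemma inKT_lift0 : inK [set: R] = lift0 (inq H).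
Proof. by rewrite inK_lift0. Qed.

Lemma colonK_lift0 : colonK (inK [set: R]) (ciR R) = lift0 (colon (inq H) (cic H)).
Proof.
rewrite inKT_lift0; apply: lift0_eq => [y _|q]; first by rewrite mul0r; left.
split=> [qR p cp|qH y].
  by apply/lift0_qfrac; rewrite qfracM; apply: qR; apply/lift0_qfrac.
move=> [->|[p cp <-]]; first by rewrite mulr0; left.
by rewrite -qfracM; apply/lift0_qfrac/qH.
Qed.

Lemma cicm_ciR (x : cicm H) : qfrac (val x) \in ciR R.
Proof. by apply/mem_set/lift0_qfrac/set_mem/(valP x). Qed.

Lemma cicm_neq0 (x : cicm H) : (Sub (qfrac (val x)) (cicm_ciR x) : ci_dom R) != 0.
Proof. by apply: contra_neq (qfrac_neq0 (val x)) => /(congr1 val); rewrite SubK. Qed.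

(** The isomorphism from the complete integral closure of the monoid of nonzero
    elements onto the nonzero elements of the complete integral closure of the
    domain. *)
Definition cicm_nz (x : cicm H) : nz (ci_dom R) := mk_nz (cicm_neq0 x).

Lemma cicm_nzM : {morph cicm_nz : a b / monoid.mul a b >-> monoid.mul a b}.
Proof. by move=> a b; do 2!apply: val_inj; rewrite /= qfracM. Qed.

Lemma cicm_nz_inj : injective cicm_nz.
Proof. by move=> a b /(congr1 (val \o val)) /= /qfrac_inj/val_inj. Qed.

Lemma cicm_nz_surj (y : nz (ci_dom R)) : exists x : cicm H, cicm_nz x = y.
Proof.
have y0 : val (val y) != 0 :> K by apply: contra_neq (valP y) => y0; apply: val_inj.
have [q qy] := qfrac_surj y0.
have cq : cic H q by apply/lift0_qfrac; rewrite qy; apply/set_mem/(valP (val y)).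
by exists (Sub q (mem_set cq)); do 2!apply: val_inj.
Qed.

End DomainTransport.

(** * The equivalences *)

Local Open Scope classical_set_scope.
Local Open Scope ereal_scope.

Lemma strongly_primary_equivalences (H : cmonoidType) : strongly_primary H ->
     let f := colon (inq H) (cic H) in
     let m := [set toq a | a in nonunits H] in
     [/\ globally_tame H <-> \bigcap_(u in atoms H) prideal u !=set0,
         globally_tame H -> \bigcap_(u in atoms H) prideal u !=set0,
         \bigcap_(u in atoms H) prideal u !=set0 -> rho H < +oo,
         rho H < +oo -> (forall k : nat, (0 < k)%N -> rho_ H k < +oo) &
         (forall k : nat, (0 < k)%N -> rho_ H k < +oo) -> Lambda H = +oo] /\
     (f !=set0 ->
       [<-> globally_tame H;
         \bigcap_(u in atoms H) prideal u !=set0;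
         rho H < +oo;
         forall k : nat, (0 < k)%N -> rho_ H k < +oo;
         Lambda H = +oo;
         primary (cicm H) /\ valuation (cicm H);
         valuation (cicm H);
         setmul f m `<=` \bigcap_(u in atoms H) dil (toq u) (cic H);
         setmul (setmul f f) m `<=`
           \bigcap_(u in atoms H) dil (toq u) (inq H)]).
Proof.
move=> spH f m.
have common_tame : \bigcap_(u in atoms H) prideal u !=set0 -> globally_tame H.
  by move=> /common_multipleP[c uc]; apply: common_multiple_tame uc.
have common_rho : \bigcap_(u in atoms H) prideal u !=set0 -> rho H < +oo.
  by move=> /common_multipleP[c uc]; apply: common_multiple_rho uc.
split.
  split=> //; first by split=> //; apply: tame_common_multiple.
  - exact: tame_common_multiple.
  - by move=> r k _; apply: rho_rho_k.
  - exact: rho_k_Lambda.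
move=> f0; tfae.
- exact: tame_common_multiple.
- exact: common_rho.
- by move=> r k _; apply: rho_rho_k.
- exact: rho_k_Lambda.
- move=> /(Lambda_cic spH)/valuation_cicm V; split=> //.
  exact: primary_cicm.
- by case.
- exact: valuation_conductor.
- exact: valuation_conductor2.
- by move=> /(conductor_common_multiple spH f0)/common_tame.
Qed.

Theorem theorem3p8 :
  (forall H : cmonoidType, strongly_primary H ->
     let f := colon (inq H) (cic H) in
     let m := [set toq a | a in nonunits H] in
     [/\ globally_tame H <-> \bigcap_(u in atoms H) prideal u !=set0,
         globally_tame H -> \bigcap_(u in atoms H) prideal u !=set0,
         \bigcap_(u in atoms H) prideal u !=set0 -> rho H < +oo,
         rho H < +oo -> (forall k : nat, (0 < k)%N -> rho_ H k < +oo) &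
         (forall k : nat, (0 < k)%N -> rho_ H k < +oo) -> Lambda H = +oo] /\
     (f !=set0 ->
       [<-> globally_tame H;
         \bigcap_(u in atoms H) prideal u !=set0;
         rho H < +oo;
         forall k : nat, (0 < k)%N -> rho_ H k < +oo;
         Lambda H = +oo;
         primary (cicm H) /\ valuation (cicm H);
         valuation (cicm H);
         setmul f m `<=` \bigcap_(u in atoms H) dil (toq u) (cic H);
         setmul (setmul f f) m `<=`
           \bigcap_(u in atoms H) dil (toq u) (inq H)]))
  /\
  (forall (R : idomainType) (M : set R),
     local_with M -> strongly_primary_domain R ->
     let f := colonK (inK [set: R]) (ciR R) in
     [<-> globally_tame_domain R;
       \bigcap_(u in atoms (nz R)) prideal u !=set0;
       rho (nz R) < +oo;
       forall k : nat, (0 < k)%N -> rho_ (nz R) k < +oo;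
       Lambda (nz R) = +oo;
       [/\ primary_domain (ci_dom R), valuation_domain (ci_dom R) &
           f <> [set 0%R]];
       valuation_domain (ci_dom R) /\ f <> [set 0%R];
       [set 0%R] <> setmulK f (inK M) /\
         setmulK f (inK M) `<=`
           \bigcap_(u in atoms (nz R)) dilK (FracField.tofrac (val u)) (ciR R);
       [set 0%R] <> setmulK (setmulK f f) (inK M) /\
         setmulK (setmulK f f) (inK M) `<=`
           \bigcap_(u in atoms (nz R)) dilK (FracField.tofrac (val u)) (inK [set: R])]).
Proof.
split=> [|R M locM spR f]; first exact: strongly_primary_equivalences.
pose H : cmonoidType := nz R.
pose fH := colon (inq H) (cic H); pose mH := [set toq a | a in nonunits H].
have fE : f = lift0 fH by apply: colonK_lift0.
have mE : inK M = lift0 mH.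
  rewrite (local_nonunits spR locM) inK_lift0; last first.
    by move=> -[s] /esym/eqP; rewrite GRing.mul0r GRing.oner_eq0.
  congr (lift0 [set _ | _ in _]); apply/seteqP; split=> a /= na.
    by move=> [s /(congr1 val) as1]; apply: na; exists (val s).
  by move=> [s as1]; apply: na; apply: unit_nz as1.
have m0 : mH !=set0.
  by have [b nb] := exists_nonunit spR; exists (toq b), b.
have nzf : f <> [set 0%R] <-> fH !=set0.
  by rewrite -lift0_nonzero -fE; split=> /nesym.
have valE : valuation_domain (ci_dom R) <-> valuation (cicm H).
  split; last exact: iso_valuation (@cicm_nzM R) (@cicm_nz_inj R) (@cicm_nz_surj R).
  exact: iso_valuation_inv (@cicm_nzM R) (@cicm_nz_inj R) (@cicm_nz_surj R).
have [[[tame_common common_tame] _ common_rho rho_rhok rhok_Lambda] _] :=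
  strongly_primary_equivalences spR.
rewrite fE mE inKT_lift0 (_ : ciR R = lift0 (cic H)) // !setmulK_lift0.
tfae=> //.
- move=> LR; have fn0 := Lambda_conductor spR LR.
  have V := valuation_cicm (Lambda_cic spR LR); split.
  + apply: (iso_primary (@cicm_nzM R) (@cicm_nz_inj R) (@cicm_nz_surj R)).
    exact: primary_cicm.
  + exact/valE.
  + by rewrite -fE; apply/nzf.
- by case.
- rewrite -fE => -[/valE V /nzf [x fx]]; split.
    by apply/lift0_nonzero; have [y my] := m0; exists (x * y)%g, x => //; exists y.
  exact/sub_bigcap_dilK/valuation_conductor.
- move=> [/lift0_nonzero[_ [x fx [y my _]]] /sub_bigcap_dilK fm]; split.
    apply/lift0_nonzero; exists (x * x * y)%g, (x * x)%g; last by exists y.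
    by exists x => //; exists x.
  exact/sub_bigcap_dilK/valuation_conductor2.
- move=> [/lift0_nonzero[_ [_ [x fx _] _]] /sub_bigcap_dilK ffm].
  apply: common_tame; apply: conductor_common_multiple ffm => //.
  by exists x.
Qed.
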